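(* For every integer $k\ge 2$ there exists a constant $d_k>0$ such that for all positive integers $m,n$, $$z(m,n,C_{2k})\le (k-1)n+d_k\cdot m^{1+1/\lfloor k/2\rfloor}.$$
   Context: The Zarankiewicz number $z(m,n,C_{2k})$ is the maximum number of edges in a bipartite graph with two parts of sizes $m$ and $n$ that contains no cycle of length $2k$. *)

(* Defs.v *)
From mathcomp Require Import all_boot.

Set Implicit Arguments.
Unset Strict Implicit.
Unset Printing Implicit Defensive.

(* A bipartite graph with parts 'I_m and 'I_n is given by its edge set
   E : {set 'I_m * 'I_n}; its vertex set is the disjoint union 'I_m + 'I_n. *)
Definition bip_adj (m n : nat) (E : {set 'I_m * 'I_n}) : rel ('I_m + 'I_n) :=
  fun u v => match u, v with
  | inl x, inr y => (x, y) \in E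
  | inr y, inl x => (x, y) \in E
  | _, _ => false
  end.

(* The graph contains a cycle C_l: l distinct vertices, cyclically adjacent.
   This is the graph-theoretic notion only for l >= 3 (for l = 2 a single edge
   would count). *)
Definition has_cycle (m n l : nat) (E : {set 'I_m * 'I_n}) : bool :=
  [exists c : l.-tuple ('I_m + 'I_n), ucycleb (bip_adj E) c].

(* z(m, n, C_l).  The empty graph is C_l-free for l > 0, so the maximum is over
   a nonempty family. *)
Definition zarankiewicz (m n l : nat) : nat :=
  \max_(E : {set 'I_m * 'I_n} | ~~ has_cycle l E) #|E|.

(* Main.v *)
Require Import Defs.
From mathcomp Require Import all_boot all_order all_algebra.
From mathcomp Require Import reals exp.
From mathcomp Require Import zify.

Set Implicit Arguments.
Unset Strict Implicit.
Unset Printing Implicit Defensive.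

(** Read a bipartite graph as a hypergraph: the vertices are the m left
    vertices, the hyperedges are the neighbourhoods of the n right vertices.
    A cycle of length 2k is then a Berge cycle of length k. Right vertices of
    degree below k account for the term (k-1)n, so it remains to see that the
    right vertices of degree at least k carry O(m^(1+1/l)) edges altogether,
    where l = floor(k/2). Up to the last section m^(1/l) is represented by an
    integer M with m < M^l, and bounds have the form c * M * m.

    The engine is breadth-first search ([cycle_of_layer_paths]). Let g be a
    graph between a part S of the sphere of radius j and a part W of the next
    sphere. Take the least E such that, for each w in W, all g-neighbours of w
    have the same E-th ancestor; some w then has neighbours s and s' with
    different (E-1)-st ancestors. Walk from w along any simple g-path that
    avoids s and s' and ends in S. Two S-vertices that are consecutive on the
    path share a neighbour in W, so the E-th ancestor never changes and the end
    of the path branches off from s or from s' exactly at height E. Closing up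
    through the tree gives a cycle, and the length of the path is free, so all
    even lengths above 2j occur. Hence consecutive spheres of a C_2k-free graph
    span few edges ([lower_layer], [upper_layer]); when the degrees are at
    least c(M+3) each step multiplies the size of the spheres by M ([growth]),
    and l steps exceed the m available vertices. This is carried out for
    bipartite graphs whose degrees are large on one side only
    ([degree_excess_bound]) and for C_2l-free graphs on m vertices
    ([bipartite_even_cycle_bound]).

    The first bound settles the right vertices of degree at least 4k+7. For
    the others only their number matters. Call a pair of left vertices heavy if
    it has k common neighbours of degree at least k, and light otherwise. The
    neighbourhood of a right vertex b of degree at least k contains a light
    pair, since k pairwise heavy vertices greedily form a Berge cycle. If all
    pairs in the neighbourhood of b are light, the first bound applies again,
    because only boundedly many right vertices obstruct a step of a path.
    Otherwise b has neighbours x, y, z with xy light and yz heavy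
    ([mixed_pair_triple]). A fixed proportion of these b is coloured correctly
    by a single 3-colouring ([rainbow_colouring]), and the light pairs xy,
    each of which comes from few b, form a bipartite graph. A cycle C_2l in
    it lifts to a Berge cycle of length 2l, and, when k = 2l+1, to one of length
    k by replacing one edge xy with the path x, z, y that uses b and a further
    common neighbour of z and y ([light_family_bound]). *)

(** * Breadth-first spheres and parent pointers *)

Section Spheres.
Variables (T : finType) (e : rel T) (r : T).

Fixpoint ball i :=
  if i is j.+1 then ball j :|: [set y | [exists x in ball j, e x y]]
  else [set r].

Definition sphere i := if i is j.+1 then ball i :\: ball j else [set r].

Lemma ball_mono i j : i <= j -> ball i \subset ball j.
Proof.
move=> /subnK <-; elim: (j - i) => [|d IH] //=.
by apply: subset_trans IH _; apply: subsetUl.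
Qed.

Lemma sphere_sub_ball i : sphere i \subset ball i.
Proof. by case: i => [|i] //=; apply: subsetDl. Qed.

Lemma sphere_inj x i j : x \in sphere i -> x \in sphere j -> i = j.
Proof.
wlog lt_ij: i j / i < j => [H xi xj|xi].
  by case: (ltngtP i j) => // h; [exact: H|apply/esym/H].
case: j lt_ij => // j; rewrite ltnS => le_ij /=; rewrite inE => /andP[/negP xj _].
by case: xj; apply: (subsetP (ball_mono le_ij)); apply: (subsetP (sphere_sub_ball i)).
Qed.

Lemma ball_sphere x i : x \in ball i -> exists2 j, j <= i & x \in sphere j.
Proof.
elim: i => [|i IH] xi; first by exists 0.
case: (boolP (x \in ball i)) => [/IH[j ji xj]|xni]; first by exists j => //; exact: ltnW.
by exists i.+1 => //; rewrite [sphere _]/(ball _ :\: ball _) in_setD xni.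
Qed.

Lemma sphere_adj x y i : x \in sphere i -> e x y ->
  exists2 j, j <= i.+1 & y \in sphere j.
Proof.
move=> xi exy; apply: ball_sphere => /=; rewrite !inE; apply/orP; right.
by apply/existsP; exists x; rewrite exy andbT; exact: (subsetP (sphere_sub_ball i)).
Qed.

(** A neighbour of [y] in the ball of radius [i] cannot lie in a smaller
    sphere, as [y] would then be in the ball of radius [i]. *)
Lemma sphere_pred y i : y \in sphere i.+1 -> exists2 x, x \in sphere i & e x y.
Proof.
rewrite /= !inE => /andP[yn /orP[|/existsP[x /andP[xi exy]]]]; first by rewrite (negPf yn).
have [j ji xj] := ball_sphere xi.
have [j' j'j yj'] := sphere_adj xj exy.
exists x => //; have [<-//|ne] := eqVneq j i.
have lt: j.+1 <= i by rewrite ltn_neqAle ne.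
case/negP: yn; apply: (subsetP (ball_mono (leq_trans j'j lt))).
exact: (subsetP (sphere_sub_ball _)).
Qed.

Hypothesis esym : symmetric e.

Lemma sphere_adj_dist x y i j : x \in sphere i -> y \in sphere j -> e x y ->
  (i <= j.+1) && (j <= i.+1).
Proof.
move=> xi yj exy; have [i' li yi] := sphere_adj xi exy.
have eyx : e y x by rewrite esym.
have [j' lj xj] := sphere_adj yj eyx.
by rewrite {1}(sphere_inj xi xj) lj (sphere_inj yj yi) li.
Qed.

Variable L : nat.

(** The bound [L] on the radius keeps the existential over a finite type, so
    that [pick] can choose the parent; it only has to be at least as large as
    the radii in use. *)
Definition parent x :=
  odflt x [pick y | e y x & [exists i : 'I_L, (y \in sphere i) && (x \in sphere i.+1)]].

Lemma parentP x i : i < L -> x \in sphere i.+1 ->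
  parent x \in sphere i /\ e (parent x) x.
Proof.
move=> iL xi; rewrite /parent; case: pickP => [y /andP[eyx /existsP[j /andP[yj xj]]] | no] /=.
  by case: (sphere_inj xi xj) => ->.
have [y yi eyx] := sphere_pred xi.
by have /negP[] := no y; rewrite eyx; apply/existsP; exists (Ordinal iL); rewrite yi.
Qed.

Lemma iter_parent_sphere x j d : j <= L -> d <= j -> x \in sphere j ->
  iter d parent x \in sphere (j - d).
Proof.
move=> jL; elim: d => [|d IH] dj xj; first by rewrite subn0.
have := IH (ltnW dj) xj; have -> : j - d = (j - d.+1).+1 by lia.
by move=> h; have [] := parentP _ h; [lia|].
Qed.

Lemma iter_parent_adj x j d : j <= L -> d < j -> x \in sphere j ->
  e (iter d parent x) (iter d.+1 parent x).
Proof.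
move=> jL dj xj; have := iter_parent_sphere jL (ltnW dj) xj.
have -> : j - d = (j - d.+1).+1 by lia.
by move=> h; rewrite esym; have [] := parentP _ h; [lia|].
Qed.

(** Vertices of the two branches at different heights lie in different
    spheres, and at equal heights below [d] they differ because the branches
    have not merged yet; the path [q] never enters the smaller spheres. *)
Lemma cycle_of_diverging_branches x y q j d :
  j <= L -> 0 < d <= j -> x \in sphere j -> y \in sphere j ->
  iter d parent x = iter d parent y ->
  iter d.-1 parent x != iter d.-1 parent y ->
  path e x q -> last x q = y -> uniq (x :: q) ->
  (forall z i, z \in q -> z \in sphere i -> j <= i) ->
  exists2 c, ucycle e c & size c = size q + 2 * d.
Proof.
move=> jL; case: d => // d dj xj yj eqd neqd pq lq uq qout.
set ty := traject parent (parent y) d.+1.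
set tx := traject parent (parent x) d.
have adj z n : z \in sphere j -> n <= d.+1 ->
    path e z (traject parent (parent z) n).
  move=> zj nd; apply/(pathP z) => i; rewrite size_traject => ni.
  rewrite -[z :: traject _ _ _]/(traject parent z n.+1) nth_traject; last exact: ltnW.
  rewrite (set_nth_default (parent z)) ?size_traject // nth_traject // -iterSr.
  by apply: (iter_parent_adj jL) => //; lia.
have mem_tr z n u : z \in sphere j -> n <= d.+1 -> u \in traject parent (parent z) n ->
    exists i, [/\ i < n, u = iter i.+1 parent z & u \in sphere (j - i.+1)].
  move=> zj nd /trajectP[i ni ->]; exists i; rewrite -iterSr; split=> //.
  by apply: iter_parent_sphere => //; lia.
have uniq_tr z n : z \in sphere j -> n <= d.+1 -> uniq (traject parent (parent z) n).
  move=> zj nd; apply/(uniqP z) => a b; rewrite !inE size_traject => an bn.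
  rewrite !(set_nth_default (parent z) z) ?size_traject // !nth_traject // -!iterSr => eqab.
  have ha := iter_parent_sphere jL (_ : a.+1 <= j) zj.
  have hb := iter_parent_sphere jL (_ : b.+1 <= j) zj.
  rewrite eqab in ha; have := sphere_inj (ha _) (hb _); lia.
exists (x :: q ++ ty ++ rev tx).
  apply/andP; split.
    rewrite /= rcons_cat cat_path pq lq /= rcons_cat cat_path.
    have /= := adj y d.+1 yj (leqnn _); rewrite -/ty => /andP[-> ->] /=.
    have -> : last (parent y) (traject parent (parent (parent y)) d) =
              last x (rcons tx (parent (last x tx))).
      rewrite last_rcons.
      have -> : last x tx = iter d parent x.
        by rewrite /tx last_traject.
      by rewrite last_traject -iterSr -eqd.
    have -> : last x tx = iter d parent x by rewrite /tx last_traject.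
    have -> : rcons (rev tx) x = rev (belast x (rcons tx (iter d.+1 parent x))).
      by rewrite belast_rcons -rev_cons.
    have -> : rcons tx (iter d.+1 parent x) = traject parent (parent x) d.+1.
      by rewrite trajectSr /tx iterSr.
    rewrite rev_path.
    have := adj x d.+1 xj (leqnn _).
    by apply: sub_path => u v; rewrite /= esym.
  have Uy : uniq ty by exact: uniq_tr.
  have Ux : uniq tx by exact: uniq_tr (leqnSn _).
  rewrite -cat_cons cat_uniq uq cat_uniq rev_uniq Ux Uy andbT !andTb.
  apply/andP; split; last first.
    apply/hasPn => u; rewrite mem_rev => /(mem_tr _ _ _ xj (leqnSn _))[a [ad ua uj]].
    apply/negP => /(mem_tr _ _ _ yj (leqnn _))[b [bd ub ujb]].
    have ab: a = b by have := sphere_inj uj ujb; lia.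
    move/eqP: neqd; apply => /=.
    have -> : d = (d - a.+1) + a.+1 by lia.
    by rewrite !iterD -ua ub ab.
  apply/hasPn => u; rewrite mem_cat mem_rev => h.
  have [i [id uj]] : exists i, i < j /\ u \in sphere i.
    case/orP: h => /mem_tr => [/(_ yj (leqnn _))|/(_ xj (leqnSn _))] [a [ad _ ua]];
    by exists (j - a.+1); split=> //; lia.
  apply/negP; rewrite inE => /orP[/eqP ux|uq'].
    by rewrite ux in uj; have := sphere_inj xj uj; lia.
  by have := qout _ _ uq' uj; lia.
rewrite -cat1s !size_cat size_rev !size_traject /=; lia.
Qed.

End Spheres.

(** The asymmetric role of [S] and [W] matters: the tree paths start in [S]
    and go to smaller spheres, so they never meet [W], and the connecting path
    may use [W] freely. Since [j < N], the required length 2(N-E)-1 of the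
    path from [w] is positive. *)
Lemma cycle_of_layer_paths (T : finType) (e : rel T) (r : T) (g : rel T)
    (S W : {set T}) (N j : nat) :
  symmetric e -> symmetric g -> j < N ->
  S \subset sphere e r j -> W \subset sphere e r j.+1 ->
  (forall x y, g x y -> e x y) ->
  (forall x y, g x y -> (x \in S) && (y \in W) || (x \in W) && (y \in S)) ->
  (exists w s s', [/\ w \in W, g w s, g w s' & s != s']) ->
  (forall w s s' p, w \in W -> g w s -> g w s' -> s != s' -> 0 < p <= N ->
     exists q, [/\ path g w q, size q = 2 * p - 1, uniq (w :: q), s \notin q & s' \notin q]) ->
  exists2 c, ucycle e c & size c = 2 * N.
Proof.
move=> esym gsym jN SS WW ge gSW [w0 [s0 [s0' [w0W gs0 gs0' ne0]]]] H.
set par := parent e r N.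
have inS x : x \in S -> x \in sphere e r j by apply/subsetP.
have inW x : x \in W -> x \in sphere e r j.+1 by apply/subsetP.
have SnW x : x \in S -> x \notin W.
  by move=> xS; apply/negP => /inW h; have := sphere_inj (inS _ xS) h; lia.
have SW x : x \in S -> x \in W -> False by move=> /SnW/negP.
have gW w s : w \in W -> g w s -> s \in S.
  by move=> wW /gSW/orP[/andP[wS _]|/andP[]] //; case: (SW _ wS wW).
have gS s w : s \in S -> g s w -> w \in W.
  by move=> sS /gSW/orP[/andP[]|/andP[sW _]] //; case: (SW _ sS sW).
pose agree E := [forall w, forall s, forall s',
  (w \in W) && g w s && g w s' ==> (iter E par s == iter E par s')].
have agreeP E : reflect (forall w s s', w \in W -> g w s -> g w s' -> iter E par s = iter E par s') (agree E).
  apply: (iffP forallP) => [h w s s' wW gs gs'|h w].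
    by apply/eqP; have /forallP/(_ s)/forallP/(_ s') := h w; rewrite wW gs gs'.
  apply/forallP => s; apply/forallP => s'; apply/implyP => /andP[/andP[wW gs] gs'].
  by apply/eqP; apply: (h w).
have agj : agree j.
  apply/agreeP => w s s' wW /(gW _ _ wW)/inS sj /(gW _ _ wW)/inS sj'.
  have:= iter_parent_sphere (ltnW jN) (leqnn j) sj.
  have:= iter_parent_sphere (ltnW jN) (leqnn j) sj'.
  by rewrite subnn /= !inE => /eqP -> /eqP.
case: (ex_minnP (ex_intro agree j agj)) => E /agreeP agE minE.
have Ej : E <= j by apply: minE.
have E0 : 0 < E.
  case: (E) agE => // /(_ w0 s0 s0' w0W gs0 gs0') /= h; by rewrite h eqxx in ne0.
(* minimality of E provides s and s' that have not merged one level lower *)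
have : ~~ agree E.-1 by apply/negP => /minE; clear -E0; lia.
rewrite negb_forall => /existsP[w]; rewrite negb_forall => /existsP[s].
rewrite negb_forall => /existsP[s']; rewrite negb_imply => /andP[/andP[/andP[wW gs] gs'] nE].
have ss' : s != s' by apply: contraNneq nE => ->.
have [|q [pq sq uq sNq s'Nq]] := H w s s' (N - E) wW gs gs' ss'; first by clear -jN Ej; lia.
(* the invariant: at a vertex of S the ancestor itself, at a vertex of W the
   common ancestor of all its neighbours *)
have same : forall a p, path g a p ->
    (a \in S -> iter E par a = iter E par s) ->
    (a \in W -> forall t, g a t -> iter E par t = iter E par s) ->
    (last a p \in S -> iter E par (last a p) = iter E par s).
  move=> a p; elim: p a => [|b p IH] a /=; first by move=> _ h _ /h.
  move=> /andP[gab pb] hS hW; apply: IH => //.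
    move=> bS; apply: (hW _ _ gab); move: (gSW _ _ gab); rewrite bS andbT => /orP[/andP[_]|//].
    by rewrite (negPf (SnW _ bS)).
  move=> bW t gbt; have aS : a \in S by apply: gW bW _; rewrite gsym.
  by rewrite -(hS aS); apply: (agE b) => //; rewrite gsym.
have lastS : forall p a, path g a p ->
    (a \in W -> odd (size p) -> last a p \in S) /\ (a \in S -> ~~ odd (size p) -> last a p \in S).
  elim=> [|b p IH] a //= /andP[gab /IH[h1 h2]]; split=> [aW op|aS].
    exact: h2 (gW _ _ aW gab) op.
  by rewrite negbK => /(h1 (gS _ _ aS gab)).
have odq : odd (size q).
  have -> : size q = (N - E.+1).*2.+1 by rewrite sq -addnn; clear -jN Ej; lia.
  by rewrite /= odd_double.
set u := last w q; have uS : u \in S by have [/(_ wW odq)] := lastS _ _ pq.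
clear odq.
have eqE : iter E par u = iter E par s.
  apply: (same w q) => //; first by move=> /SW/(_ wW).
  by move=> _ t gt; apply: (agE w).
suff close t : g w t -> t \notin q -> iter E.-1 par t != iter E.-1 par u ->
    exists2 c, ucycle e c & size c = 2 * N.
  case: (eqVneq (iter E.-1 par s) (iter E.-1 par u)) => h; last exact: close h.
  by apply: (close s') => //; rewrite -h eq_sym.
move=> gt tNq nEt.
have gqout : {in q, forall z, (z \in S) || (z \in W)}.
  move=> z; move: pq; elim: (q) (w) => // b p IH a /= /andP[gab pb].
  rewrite inE => /orP[/eqP->|]; last exact: IH pb.
  by have /orP[/andP[_ ->]|/andP[_ ->]] := gSW _ _ gab; rewrite ?orbT.
have tS := gW _ _ wW gt.
have [|||||||c cc sc] := @cycle_of_diverging_branches _ e r esym N t u (w :: q) j E (ltnW jN) _ (inS _ tS) (inS _ uS).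
- by rewrite E0.
- by rewrite eqE; apply: (agE w).
- exact: nEt.
- by rewrite /= esym (ge _ _ gt); apply: sub_path pq; apply: ge.
- by [].
- rewrite cons_uniq uq andbT inE negb_or tNq andbT.
  by apply: contraTneq wW => <-; apply: SnW.
- move=> z i; rewrite inE => /orP[/eqP->|/gqout/orP[/inS h|/inW h]] zi.
  + by rewrite -(sphere_inj (inW _ wW) zi).
  + by rewrite -(sphere_inj h zi).
  + by rewrite -(sphere_inj h zi).
- by exists c => //; rewrite sc /= sq; clear -jN Ej E0; lia.
Qed.

(** * Numerical growth and passing to dense subgraphs *)

(** In both uses [a i] is the size of the i-th sphere considered and [w i] the
    number of edges that lead from the i-th to the next one, while c(M+3) is a
    lower bound for the degrees. By induction [a i <= a i.+1], so of the edges
    at level i.+1 at most 3c [a i.+1] are accounted for by smaller terms and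
    the remaining cM [a i.+1] force [a i.+2] to be large. *)
Lemma growth (a w : nat -> nat) c M l :
  0 < c -> 0 < M -> 0 < a 0 ->
  (forall i, i < l -> w i <= c * (a i + a i.+1)) ->
  (0 < l -> c * (M + 3) * a 0 <= w 0) ->
  (forall i, i.+1 < l -> c * (M + 3) * a i.+1 <= w i + w i.+1) ->
  M ^ l <= a l.
Proof.
move=> c0 M0 a0 wle D0 DS.
have step i : i < l -> (M * a i <= a i.+1) && (a i <= a i.+1).
  elim: i => [|i IH] il.
    have h1 := wle 0 il; have h2 := leq_trans (D0 il) h1.
    have : (M + 3) * a 0 <= a 0 + a 1 by rewrite -(leq_pmul2l c0) mulnA.
    rewrite mulnDl; lia.
  have /andP[_ a_le] := IH (ltnW il).
  have h1 := wle _ il; have h0 := wle _ (ltnW il).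
  have h2 := leq_trans (DS _ il) (leq_add h0 h1).
  have : (M + 3) * a i.+1 <= a i + a i.+1 + (a i.+1 + a i.+2).
    by rewrite -(leq_pmul2l c0) mulnA [c * (_ + _ + _)]mulnDr.
  rewrite mulnDl; have := leq_pmull (a i.+1) M0; lia.
have : forall i, i <= l -> M ^ i <= a i.
  elim=> [|i IH] il; first by rewrite expn0.
  have /andP[h _] := step _ il; rewrite expnS; apply: leq_trans h.
  by rewrite leq_mul2l IH ?orbT // ltnW.
by apply.
Qed.

Section Nbr.
Variables (T : finType) (e : rel T).

Definition nbr (U : {set T}) b := [set v in U | e b v].

Lemma in_nbr U b v : (v \in nbr U b) = (v \in U) && e b v.
Proof. by rewrite inE. Qed.

(** Each vertex of [Bs] is charged only for its degree above [q]. Deleting a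
    vertex [v] then costs one for each neighbour of degree above [q], and
    nothing for a neighbour that is already too poor, however large [Bs] is;
    hence a smallest subset whose excess is above [c] times its size works. *)
Lemma prune_side (Bs U0 : {set T}) q c :
  c * #|U0| < \sum_(b in Bs) (#|nbr U0 b| - q) ->
  exists U : {set T}, [/\ U \subset U0, U != set0 &
    forall v, v \in U -> c < #|[set b in Bs | e b v && (q < #|nbr U b|)]|].
Proof.
pose f U := \sum_(b in Bs) (#|nbr U b| - q) => big0.
pose P (U : {set T}) := (U \subset U0) && (c * #|U| < f U).
have PU0 : P U0 by rewrite /P subxx.
case: (@arg_minnP _ U0 P (fun U => #|U|) PU0) => U /andP[UU0 fU] minU.
exists U; split=> //.
  apply: contraTneq fU => ->; rewrite cards0 muln0 -leqNgt /f big1 // => b _.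
  by rewrite (_ : nbr set0 b = set0) ?cards0 //; apply/setP => x; rewrite in_nbr !inE.
move=> v vU; have cU := cardsD1 v U; rewrite vU in cU.
have nP : f (U :\ v) <= c * #|U :\ v|.
  rewrite leqNgt; apply: contraT; rewrite negbK => h.
  have : P (U :\ v) by rewrite /P h (subset_trans (subsetDl _ _) UU0).
  by move/minU; lia.
have fle : f U <= f (U :\ v) + #|[set b in Bs | e b v && (q < #|nbr U b|)]|.
  have -> : #|[set b in Bs | e b v && (q < #|nbr U b|)]| =
      \sum_(b in Bs) (e b v && (q < #|nbr U b|)).
    rewrite -sum1_card (eq_bigl (fun b => (b \in Bs) && (e b v && (q < #|nbr U b|)))).
      by rewrite big_mkcondr; apply: eq_bigr => b _; case: ifP.
    by move=> b; rewrite inE.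
  rewrite -big_split /=; apply: leq_sum => b bB.
  have := cardsD1 v (nbr U b); rewrite in_nbr vU /=.
  rewrite (_ : nbr U b :\ v = nbr (U :\ v) b); last by apply/setP => x; rewrite in_setD1 !in_nbr in_setD1 andbA.
  by case: (e b v) => /= ->; rewrite ?add0n ?addn0 //; case: (ltnP q) => /=; lia.
nia.
Qed.

End Nbr.

(** Greedy construction: each application of the hypothesis avoids the
    vertices used so far. *)
Lemma two_step_path (T : finType) (g : rel T) (U : {set T}) D :
  (forall x y, g x y -> x != y) ->
  (forall a (X : {set T}), a \in U -> #|X| <= D ->
     exists b a', [/\ g a b, g b a', a' \in U, b \notin X & a' \notin X]) ->
  forall n a (X : {set T}), a \in U -> #|X| + 2 * n <= D ->
  exists q, [/\ path g a q, size q = 2 * n, uniq (a :: q) & {in q, forall z, z \notin X}].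
Proof.
move=> girr H; elim=> [|n IH] a X aU sX; first by exists [::].
have [|b [a' [gab gba' a'U bX a'X]]] := H a (a |: X) aU.
  by rewrite cardsU1; case: (a \notin X) => /=; lia.
rewrite !inE !negb_or in bX a'X; case/andP: bX => ba bX; case/andP: a'X => a'a a'X.
have [|q [pq sq uq qX]] := IH a' (b |: (a |: X)) a'U.
  rewrite !cardsU1 !inE; case: (_ || _); case: (_ \in _) => /=; lia.
have qX' z : z \in q -> [&& z != b, z != a & z \notin X].
  by move=> /qX; rewrite !inE !negb_or.
exists [:: b, a' & q]; split=> //.
- by rewrite /= gab gba'.
- by rewrite /= sq; lia.
- rewrite cons_uniq [uniq (b :: _)]cons_uniq uq andbT !inE !negb_or eq_sym ba eq_sym a'a /=.
  rewrite girr //= ; apply/andP; split; apply/negP => /qX'/and3P[]; by rewrite eqxx.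
- by move=> z; rewrite !inE => /or3P[/eqP->|/eqP->|/qX'/and3P[]].
Qed.

(** * Few edges between consecutive spheres *)

Lemma leq_card_bigcup (T I : finType) (P : {set I}) (F : I -> {set T}) K :
  (forall i, i \in P -> #|F i| <= K) -> #|\bigcup_(i in P) F i| <= #|P| * K.
Proof.
move=> FK; apply: leq_trans (_ : \sum_(i in P) #|F i| <= _); last first.
  by rewrite -sum_nat_const; apply: leq_sum.
elim/big_rec2: _ => [|i s B _ IH]; first by rewrite cards0.
by apply: leq_trans (leq_card_setU _ _) _; rewrite leq_add2l.
Qed.

Definition link (T : finType) (e : rel T) (U B : {set T}) : rel T :=
  fun x y => e x y && ((x \in U) && (y \in B) || (x \in B) && (y \in U)).

Lemma link_sym (T : finType) (e : rel T) (U B : {set T}) :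
  symmetric e -> symmetric (link e U B).
Proof. by move=> es x y; rewrite /link es orbC ![(_ \in U) && _]andbC. Qed.

Lemma card_gt2_ex (T : finType) (S : {set T}) x y :
  2 < #|S| -> exists u, [/\ u \in S, u != x & u != y].
Proof.
move=> S2; have : 0 < #|S :\: [set x; y]|.
  by rewrite cardsD; have := subset_leq_card (subsetIr S [set x; y]); rewrite cards2; case: eqP => /=; lia.
by case/card_gt0P => u; rewrite !inE negb_or => /andP[/andP[ux uy] uS]; exists u.
Qed.

Section Layer.
Variables (T : finType) (e : rel T) (r : T) (A : {set T}) (k K : nat).
Hypothesis esym : symmetric e.
Hypothesis bip : forall x y, e x y -> (x \in A) != (y \in A).

(** The two situations in which a path can be prolonged greedily through a
    right vertex with more than [q] neighbours: either so many neighbours that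
    one of them is fresh, or so few common neighbours of any two vertices of
    [A] that only boundedly many right vertices have no fresh neighbour. *)
Definition large_or_light q := 2 * k + 3 <= q \/
  forall u v, u \in A -> v \in A -> u != v -> #|[set b | e u b && e v b]| <= K.

(** At most 2k+2 vertices are avoided at a time, and each excludes itself and
    at most [K] right vertices. *)
Definition layer_const := (2 * k + 2) * (K + 1).

(** If no right vertex in reach is suitable, each of them lies in [X] or has
    all its neighbours in [a |: X]; both alternatives of [large_or_light]
    bound their number by [layer_const]. *)
Lemma two_step_dense (Bs U : {set T}) q :
  0 < q -> large_or_light q -> U \subset A ->
  (forall v, v \in U -> layer_const < #|[set b in Bs | e b v && (q < #|nbr e U b|)]|) ->
  forall a (X : {set T}), a \in U -> #|X| <= 2 * k + 2 ->
  exists b a', [/\ link e U [set b in Bs | q < #|nbr e U b|] a b,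
    link e U [set b in Bs | q < #|nbr e U b|] b a', a' \in U, b \notin X & a' \notin X].
Proof.
move=> q0 sq UA dense a X aU sX.
set C := [set b in Bs | e b a && (q < #|nbr e U b|)].
suff [b [bC bX /subsetPn[a']]] : exists b, [/\ b \in C, b \notin X & ~~ (nbr e U b \subset a |: X)].
  rewrite in_nbr in_setU1 negb_or => /andP[a'U eba'] /andP[a'a a'X].
  exists b, a'; move: bC; rewrite inE => /and3P[bB eba qb].
  by rewrite /link !inE esym eba aU eba' a'U bB qb /= orbT.
have [/existsP[b /and3P[? ? ?]]|] := boolP [exists b, [&& b \in C, b \notin X & ~~ (nbr e U b \subset a |: X)]].
  by exists b.
rewrite negb_exists => /forallP no; exfalso.
have {}no b : b \in C -> b \in X \/ nbr e U b \subset a |: X.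
  by move=> bC; move: (no b); rewrite bC /= negb_and !negbK => /orP[]; [left|right].
have sC : layer_const < #|C| by exact: dense.
case: sq => [q_big|light].
  have : C \subset X.
    apply/subsetP => b bC; case: (no b bC) => // /subset_leq_card.
    move: bC; rewrite inE => /and3P[_ _ qb].
    by rewrite cardsU1; case: (a \notin X) => /=; lia.
  move/subset_leq_card; move: sC; rewrite /layer_const mulnDr; lia.
have : C \subset X :|: \bigcup_(u in X :&: A :\ a) [set b | e u b && e a b].
  apply/subsetP => b bC; case: (no b bC) => [bX|/subsetP sub]; first by rewrite in_setU bX.
  move: bC; rewrite inE => /and3P[bB eba qb]; rewrite in_setU; apply/orP; right.
  have : 0 < #|nbr e U b :\ a|.
    have := cardsD1 a (nbr e U b); case: (a \in _) => /=; lia.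
  case/card_gt0P => u; rewrite in_setD1 in_nbr => /and3P[ua uU ebu].
  apply/bigcupP; exists u; last by rewrite inE esym ebu esym.
  rewrite in_setD1 ua inE (subsetP UA) // andbT.
  by have := sub u; rewrite in_nbr uU ebu in_setU1 (negPf ua) => /(_ isT).
move/subset_leq_card; have := (leq_card_setU X (\bigcup_(u in X :&: A :\ a) [set b | e u b && e a b])).1.
have := @leq_card_bigcup _ _ (X :&: A :\ a) (fun u => [set b | e u b && e a b]) K.
have -> : (forall i, i \in X :&: A :\ a -> #|[set b | e i b && e a b]| <= K) <-> True.
  split=> // _ i; rewrite in_setD1 inE => /and3P[ia iX iA]; apply: light => //.
  exact: (subsetP UA).
move=> /(_ I).
have : #|X :&: A :\ a| <= #|X|.
  by apply: subset_leq_card; apply/subsetP => z; rewrite !inE => /and3P[].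
move: sC; rewrite /layer_const; move: #|X :&: A :\ a| => n1 sC n1X h1 h2 h3.
have : n1 * K <= (2 * k + 2) * K by rewrite leq_mul2r (leq_trans n1X sX) orbT.
move: sC; rewrite mulnDr; lia.
Qed.

Hypothesis noC : forall c, ucycle e c -> size c <> 2 * k.

(** Applied with the [A]-side as the lower side [S]. The path from a right
    vertex must leave through a third neighbour, different from [s] and [s'],
    whence [1 < q]. *)
Lemma lower_layer j q :
  j < k -> 1 < q -> large_or_light q -> sphere e r j \subset A ->
  \sum_(b in sphere e r j.+1) (#|nbr e (sphere e r j) b| - q) <= layer_const * #|sphere e r j|.
Proof.
move=> jk q1 sq LA; rewrite leqNgt; apply/negP => /prune_side[U [UL U0 dense]].
have UA := subset_trans UL LA.
set Bs := sphere e r j.+1 in dense.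
pose B := [set b in Bs | q < #|nbr e U b|].
have step := two_step_dense (ltnW q1) sq UA dense.
have girr x y : link e U B x y -> x != y.
  by case/andP=> /bip h _; apply: contraNneq h => ->.
have gB w s : w \in B -> link e U B w s -> (s \in U) && e w s.
  rewrite /link => wB /andP[ews /orP[/andP[wU]|/andP[_ ->]//]].
  have wj := subsetP UL _ wU; move: wB; rewrite inE => /andP[wj' _].
  by have := sphere_inj wj wj'; clear; lia.
have [|||||c cc sc] := @cycle_of_layer_paths T e r (link e U B) U B k j esym (link_sym _ _ esym) jk UL.
- by apply/subsetP => b; rewrite inE => /andP[].
- by move=> x y /andP[].
- by move=> x y /andP[].
- have [v vU] := set0Pn _ U0.
  have /card_gt0P[b] : 0 < #|[set b in Bs | e b v && (q < #|nbr e U b|)]| by exact: leq_ltn_trans (dense _ vU).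
  rewrite inE => /and3P[bB _ qb].
  have [s [sN sv _]] := card_gt2_ex v v (leq_ltn_trans q1 qb).
  have [s' [s'N ss' _]] := card_gt2_ex s s (leq_ltn_trans q1 qb).
  have bBB : b \in B by rewrite inE bB qb.
  exists b, s', s; split=> //.
    by move: s'N; rewrite in_nbr /link bBB => /andP[-> ->]; rewrite orbT.
  by move: sN; rewrite in_nbr /link bBB => /andP[-> ->]; rewrite orbT.
- move=> w s s' p wB gs gs' ss' /andP[p0 pk].
  have qw : 2 < #|nbr e U w| by move: wB; rewrite inE => /andP[_]; exact: leq_ltn_trans.
  have [u [uN us us']] := card_gt2_ex s s' qw.
  move: uN; rewrite in_nbr => /andP[uU ewu].
  have [|q' [pq sq' uq qX]] := two_step_path girr step (n := p.-1) (X := [set w; s; s']) uU.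
    by rewrite -setUA cardsU1 cards2; case: (_ \notin _); case: (_ != _); clear -p0 pk; lia.
  have guw : link e U B w u by rewrite /link ewu wB uU orbT.
  have qX' z : z \in q' -> [&& z != w, z != s & z != s'].
    by move=> /qX; rewrite !inE !negb_or -andbA.
  exists (u :: q'); split.
  + by rewrite /= guw.
  + by rewrite /= sq'; clear -p0; lia.
  + rewrite cons_uniq uq andbT inE negb_or girr //=.
    by apply/negP => /qX'; rewrite eqxx.
  + by rewrite inE negb_or eq_sym us; apply/negP => /qX'/and3P[_]; rewrite eqxx.
  + by rewrite inE negb_or eq_sym us'; apply/negP => /qX'/and3P[_ _]; rewrite eqxx.
- exact: (noC cc sc).
Qed.

(** Here the right vertices form the lower side [S], and the path from [w] in
    [A] ends one step before a two-step path does; two neighbours are enough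
    for a right vertex to be passed through. *)
Lemma upper_layer j q :
  j < k -> 0 < q -> large_or_light q -> sphere e r j.+1 \subset A ->
  \sum_(b in sphere e r j) (#|nbr e (sphere e r j.+1) b| - q) <= layer_const * #|sphere e r j.+1|.
Proof.
move=> jk q0 sq LA; rewrite leqNgt; apply/negP => /prune_side[U [UL U0 dense]].
have UA := subset_trans UL LA.
set Bs := sphere e r j in dense.
pose B := [set b in Bs | q < #|nbr e U b|].
have step := two_step_dense q0 sq UA dense.
have girr x y : link e U B x y -> x != y.
  by case/andP=> /bip h _; apply: contraNneq h => ->.
have [|||||c cc sc] := @cycle_of_layer_paths T e r (link e U B) B U k j esym (link_sym _ _ esym) jk _ UL.
- by apply/subsetP => b; rewrite inE => /andP[].
- by move=> x y /andP[].
- by move=> x y /andP[_]; rewrite orbC.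
- have [v vU] := set0Pn _ U0.
  have : 1 < #|[set b in Bs | e b v && (q < #|nbr e U b|)]|.
    by apply: leq_ltn_trans (dense _ vU); rewrite /layer_const; clear; lia.
  case/card_gt1P => s [s' [sC s'C ss']]; exists v, s, s'; split=> //.
    by move: sC; rewrite inE esym => /and3P[sB evs qs]; rewrite /link evs vU inE sB qs.
  by move: s'C; rewrite inE esym => /and3P[sB evs qs]; rewrite /link evs vU inE sB qs.
- move=> w s s' p wU gs gs' ss' /andP[p0 pk].
  have [|q' [pq sq' uq qX]] := two_step_path girr step (n := p) (X := [set s; s']) wU.
    by rewrite cards2; case: (_ != _); clear -p0 pk; lia.
  have qX' z : z \in q' -> (z != s) && (z != s').
    by move=> /qX; rewrite !inE !negb_or.
  case/lastP: q' pq sq' uq qX' {qX} => [|q' z]; first by move=> _ /=; clear -p0; lia.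
  rewrite rcons_path size_rcons -rcons_cons rcons_uniq => /andP[pq _] sq' /andP[_ uq] qX.
  exists q'; split=> //; first by clear -p0 sq'; lia.
  + by apply/negP => h; have := qX s; rewrite mem_rcons inE h orbT eqxx => /(_ isT).
  + by apply/negP => h; have := qX s'; rewrite mem_rcons inE h orbT eqxx andbF => /(_ isT).
- exact: (noC cc sc).
Qed.

End Layer.

(** * Two Moore-type bounds *)

Lemma card_set_sum (T : finType) (P : {set T}) (f : pred T) :
  #|[set x in P | f x]| = \sum_(x in P) f x.
Proof.
rewrite -sum1_card (eq_bigl (fun x => (x \in P) && f x)) => [|x]; last by rewrite inE.
by rewrite big_mkcondr; apply: eq_bigr => x _; case: (f x).
Qed.

Lemma double_count (T : finType) (e : rel T) (S Q : {set T}) :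
  \sum_(v in S) #|[set b in Q | e b v]| = \sum_(b in Q) #|nbr e S b|.
Proof.
rewrite (eq_bigr (fun v => \sum_(b in Q) e b v)) => [|v _]; last exact: card_set_sum.
by rewrite exchange_big; apply: eq_bigr => b _; rewrite -card_set_sum.
Qed.

Lemma leq_sum_setU (T : finType) (P Q : {set T}) F :
  \sum_(x in P :|: Q) F x <= \sum_(x in P) F x + \sum_(x in Q) F x.
Proof.
rewrite !(big_mkcond (fun x => x \in _)) -big_split; apply: leq_sum => x _ /=.
by rewrite in_setU; case: (x \in P); case: (x \in Q); rewrite ?addn0 ?leq_addr.
Qed.

Lemma sub_ucycle (T : finType) (e e' : rel T) c :
  subrel e e' -> ucycle e c -> ucycle e' c.
Proof. by move=> ee' /andP[cc uc]; apply/andP; split=> //; apply: sub_cycle cc. Qed.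

Lemma link_alternates (T : finType) (e : rel T) (r : T) (U B : {set T}) :
  [disjoint U & B] -> r \in U -> forall i x, x \in sphere (link e U B) r i ->
  x \in (if odd i then B else U).
Proof.
move=> dUB rU; elim=> [|i IH] x; first by rewrite inE => /eqP->.
move=> /sphere_pred[y yi /andP[_ yx]]; have := IH _ yi.
rewrite /=; case: (odd i) yx => /= /orP[/andP[y1 x1]|/andP[y1 x1]] y2 //.
  by rewrite (disjointFr dUB y1) in y2.
by rewrite (disjointFr dUB y2) in y1.
Qed.

(** A right vertex with more than [q1 + q2] neighbours has more than [q1] in
    the previous sphere or more than [q2] in the next one, so that
    [lower_layer] and [upper_layer] together see a fixed fraction of all
    edges; only every second sphere enters [growth]. As 2l <= k the spheres up
    to radius 2l are within the range of the two layer bounds. *)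
Lemma degree_excess_bound (T : finType) (e : rel T) (A : {set T}) (k K l q1 q2 M : nat) :
  symmetric e -> (forall x y, e x y -> (x \in A) != (y \in A)) ->
  (forall c, ucycle e c -> size c <> 2 * k) ->
  2 * l <= k -> 1 < q1 -> 0 < q2 ->
  large_or_light e A k K q1 -> large_or_light e A k K q2 -> 0 < M -> #|A| < M ^ l ->
  \sum_(b in ~: A) (#|nbr e A b| - (q1 + q2)) <=
    (q1 + q2 + 1) * layer_const k K * (M + 3) * #|A|.
Proof.
move=> esym bip noC lk q1g q2g sp1 sp2 M0 AM; rewrite leqNgt; apply/negP.
move=> /prune_side[U [UA U0 dense]].
set q := q1 + q2 in dense *; set c0 := layer_const k K in dense *.
pose B := [set b in ~: A | q < #|nbr e U b|].
pose f := link e U B.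
have fsym : symmetric f by exact: link_sym.
have fe : subrel f e by move=> x y /andP[].
have fbip x y : f x y -> (x \in A) != (y \in A) by move/fe/bip.
have fnoC c : ucycle f c -> size c <> 2 * k by move/(sub_ucycle fe)/noC.
have fsp p : large_or_light e A k K p -> large_or_light f A k K p.
  case=> [|h]; [by left|right=> u v uA vA uv; apply: leq_trans (h u v uA vA uv)].
  by apply: subset_leq_card; apply/subsetP => b; rewrite !inE => /andP[/fe-> /fe->].
have dUB : [disjoint U & B].
  rewrite disjoint_subset; apply/subsetP => x /(subsetP UA) xA.
  by rewrite !inE xA.
have [r rU] := set0Pn _ U0.
pose L i := sphere f r i.
have LU i : L i.*2 \subset U.
  by apply/subsetP => x /(link_alternates dUB rU); rewrite odd_double.
have LB i : L i.*2.+1 \subset B.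
  by apply/subsetP => x /(link_alternates dUB rU); rewrite /= odd_double.
pose w i := \sum_(b in L i.*2.+1) #|nbr f U b|.
have c00 : 0 < c0 by rewrite /c0 /layer_const; clear; lia.
have wle i : i < l -> w i <= (q + 1) * c0 * (#|L i.*2| + #|L i.+1.*2|).
  move=> il; rewrite doubleS.
  have low := lower_layer fsym fbip fnoC (j := i.*2) _ q1g (fsp _ sp1) (subset_trans (LU i) UA).
  have upp := upper_layer fsym fbip fnoC (j := i.*2.+1) _ q2g (fsp _ sp2) (subset_trans (LU i.+1) UA).
  have {}low := low ltac:(rewrite -addnn; clear -il lk; lia).
  have {}upp := upp ltac:(rewrite -addnn; clear -il lk; lia).
  rewrite -mulnA mulnDr; apply: leq_trans (leq_mul (leqnn _) (leq_add low upp)).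
  rewrite -big_split big_distrr /=; apply: leq_sum => b bL.
  have : nbr f U b \subset nbr f (L i.*2) b :|: nbr f (L i.*2.+2) b.
    apply/subsetP => v; rewrite in_setU !in_nbr => /andP[vU fbv]; rewrite fbv !andbT.
    have [j ji vj] := sphere_adj bL fbv.
    have := sphere_adj_dist fsym bL vj fbv; have := link_alternates dUB rU vj.
    case: (eqVneq j i.*2.+1) => [->|ne1 _ dj].
      by rewrite /= odd_double (disjointFr dUB vU).
    have [jE|jE] : j = i.*2 \/ j = i.*2.+2 by clear -ne1 dj ji; lia.
      by rewrite /L -jE vj.
    by rewrite /L -jE vj orbT.
  move/subset_leq_card/leq_trans/(_ (leq_card_setU _ _)).
  have : q < #|nbr f U b|.
    have := subsetP (LB i) _ bL; rewrite inE => /andP[bA qb].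
    rewrite (_ : nbr f U b = nbr e U b) //; apply/setP => v; rewrite !in_nbr.
    case vU : (v \in U) => //=; rewrite /f /link vU (subsetP (LB i) _ bL) /= orbT andbT //.
  rewrite -/(L _) -/(L _).
  move: #|nbr f U b| #|nbr f (L i.*2) b| #|nbr f (L i.*2.+2) b| => d d1 d2 qd dd.
  apply: leq_trans (_ : (q + 1) * (d - q) <= _); last first.
    by rewrite leq_mul2l; apply/orP; right; rewrite /q; clear -dd; lia.
  have [x ->] : exists x, d = q + x.+1 by exists (d - q).-1; clear -qd; lia.
  rewrite addKn mulnDl mul1n -{1}(muln1 q); apply: leq_add => //.
  by rewrite leq_mul2l orbT.
have deg v : v \in U -> (q + 1) * c0 * (M + 3) <= #|[set b in B | f b v]|.
  move=> vU; apply: ltnW; apply: leq_trans (dense _ vU) _; apply: subset_leq_card.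
  apply/subsetP => b; rewrite inE => /and3P[bA ebv qb].
  have bB : b \in B by rewrite inE bA qb.
  by rewrite inE bB /f /link ebv bB vU orbT.
have degsum i (Q : {set T}) : (forall v b, v \in L i.*2 -> f b v -> b \in Q) ->
    (q + 1) * c0 * (M + 3) * #|L i.*2| <= \sum_(b in Q) #|nbr f U b|.
  move=> LQ; apply: leq_trans (_ : \sum_(v in L i.*2) #|[set b in Q | f b v]| <= _).
    rewrite mulnC -sum_nat_const; apply: leq_sum => v vL.
    apply: leq_trans (deg _ (subsetP (LU i) _ vL)) _.
    apply: subset_leq_card; apply/subsetP => b; rewrite inE => /andP[_ fbv].
    by rewrite inE fbv (LQ v).
  rewrite double_count; apply: leq_sum => b _; apply: subset_leq_card.
  by apply/subsetP => v; rewrite !in_nbr => /andP[/(subsetP (LU i)) -> ->].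
have : M ^ l <= #|L l.*2|.
  apply: (growth (w := w) (a := fun i => #|L i.*2|) (c := (q + 1) * c0)) => //.
  - by rewrite muln_gt0 c00 addn1.
  - by rewrite cards1.
  - move=> l0; apply: degsum => v b vL fbv.
    have [j ji bj] := sphere_adj vL (etrans (fsym v b) fbv).
    have := link_alternates dUB rU bj.
    case: j ji bj => [|[|//]] // _ _ bU.
    move: fbv; rewrite /f /link (subsetP (LU 0) _ vL) bU /=.
    have -> : v \in B = false by rewrite (disjointFr dUB) // (subsetP (LU 0)).
    by rewrite (disjointFr dUB) // !andbF.
  - move=> i il; apply: leq_trans (degsum i.+1 (L i.*2.+1 :|: L i.+1.*2.+1) _) _.
      move=> v b vL fbv; have fvb : f v b by rewrite fsym.
      have [j ji bj] := sphere_adj vL fvb.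
      have := sphere_adj_dist fsym vL bj fvb; have := link_alternates dUB rU bj.
      case: (eqVneq j i.+1.*2) => [->|ne1 _ dj].
        rewrite odd_double => bU; move: fbv; rewrite /f /link bU /=.
        have vU := subsetP (LU i.+1) _ vL.
        by rewrite (disjointFr dUB vU) (disjointFr dUB bU) !andbF.
      rewrite in_setU; have [jE|jE] : j = i.*2.+1 \/ j = i.+1.*2.+1.
          by rewrite doubleS in ne1 dj *; clear -ne1 dj; lia.
        by rewrite /L -jE bj.
      by rewrite /L -jE bj orbT.
    exact: leq_sum_setU.
have := subset_leq_card (subset_trans (LU l) UA); move: AM; clear.
move=> h1 h2 h3; by have := leq_trans h1 (leq_trans h3 h2); rewrite ltnn.
Qed.

(** A smallest subset that spans more than [c] edges per vertex; [2 * c]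
    appears because the sum of the degrees counts every edge twice. *)
Lemma prune_graph (T : finType) (h : rel T) c :
  symmetric h -> 2 * c * #|T| < \sum_(x : T) #|nbr h setT x| ->
  exists2 U : {set T}, U != set0 & forall v, v \in U -> c < #|nbr h U v|.
Proof.
move=> hsym; pose F (U : {set T}) := \sum_(x in U) #|nbr h U x|.
pose P (U : {set T}) := 2 * c * #|U| < F U => big.
have PT : P setT.
  rewrite /P cardsT; apply: leq_trans big _; rewrite /F; apply: eq_leq.
  by apply: eq_bigl => x; rewrite inE.
case: (@arg_minnP _ setT P (fun U => #|U|) PT) => U fU minU; exists U.
  by apply: contraTneq fU => ->; rewrite /P cards0 muln0 /F big_set0.
move=> v vU; have cU := cardsD1 v U; rewrite vU in cU.
have nP : F (U :\ v) <= 2 * c * #|U :\ v|.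
  rewrite leqNgt; apply/negP => /minU; rewrite cU; clear; lia.
have Fle : F U <= #|nbr h U v| + (#|nbr h U v| + F (U :\ v)).
  rewrite {1}/F (big_setD1 v) //= leq_add2l.
  apply: leq_trans (_ : \sum_(x in U :\ v) (h v x + #|nbr h (U :\ v) x|) <= _).
    apply: leq_sum => x _; rewrite (cardsD1 v (nbr h U x)) in_nbr vU hsym /= leq_add2l.
    by apply: subset_leq_card; apply/subsetP => z; rewrite !(in_nbr, in_setD1) andbA.
  rewrite big_split /= leq_add2r -(card_set_sum (U :\ v) (h v)); apply: subset_leq_card.
  by apply/subsetP => x; rewrite in_nbr inE in_setD1 => /andP[/andP[_ ->] ->].
move: fU; rewrite /P; move: nP Fle; rewrite cU mulnDr; clear; lia.
Qed.

(** After passing to large minimum degree, the bound for layers is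
    [lower_layer] with either colour class as [A]: all degrees being large,
    the threshold 2l+3 costs only a linear term, and [large_or_light] holds by
    its first alternative. *)
Lemma bipartite_even_cycle_bound (V : finType) (h : rel V) (chi : V -> bool) (l M : nat) :
  symmetric h -> (forall x y, h x y -> chi x != chi y) ->
  (forall c, ucycle h c -> size c <> 2 * l) ->
  0 < M -> #|V| < M ^ l ->
  \sum_(x : V) #|nbr h setT x| <= 2 * (layer_const l 1 * (M + 3)) * #|V|.
Proof.
move=> hsym hchi noC M0 VM; rewrite leqNgt; apply/negP => /(prune_graph hsym)[U U0 dense].
set c0 := layer_const l 1 in dense *.
pose f : rel V := fun x y => [&& h x y, x \in U & y \in U].
have fsym : symmetric f by move=> x y; rewrite /f hsym [(x \in U) && _]andbC.
have fh : subrel f h by move=> x y /and3P[].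
have fnoC c : ucycle f c -> size c <> 2 * l by move/(sub_ucycle fh)/noC.
have [r rU] := set0Pn _ U0.
pose L i := sphere f r i.
have LU i : L i \subset U.
  apply/subsetP; case: i => [|i] x; first by rewrite inE => /eqP->.
  by move=> /sphere_pred[y _ /and3P[]].
have Lchi i x : x \in L i -> chi x = chi r (+) odd i.
  elim: i x => [|i IH] x; first by rewrite inE addbF => /eqP->.
  move=> /sphere_pred[y yi /fh/hchi]; rewrite (IH _ yi) /=.
  by case: (chi x) (chi r) (odd i) => [] [] [].
pose w i := \sum_(b in L i.+1) #|nbr f (L i) b|.
have wle i : i < l -> w i <= c0 * (#|L i| + #|L i.+1|).
  move=> il; pose A := [set x | chi x == chi r (+) odd i].
  have bipA x y : f x y -> (x \in A) != (y \in A).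
    by move=> /fh/hchi; rewrite !inE; case: (chi x) (chi y) (_ (+) _) => [] [] [].
  have LA : L i \subset A by apply/subsetP => x /Lchi h1; rewrite inE h1.
  have := @lower_layer _ f r A l 1 fsym bipA fnoC i (2 * l + 3) il.
  rewrite -/(L i) -/(L i.+1) => /(_ _ _ LA) low.
  have {}low := low ltac:(by rewrite addnC) ltac:(by left).
  apply: leq_trans (_ : \sum_(b in L i.+1) ((#|nbr f (L i) b| - (2 * l + 3)) + (2 * l + 3)) <= _).
    by apply: leq_sum => b _; rewrite addnC -leq_subLR.
  rewrite big_split /= sum_nat_const [c0 * (_ + _)]mulnDr; apply: (leq_add low).
  rewrite mulnC leq_mul2r; apply/orP; right; rewrite /c0 /layer_const; clear; lia.
have degL i : c0 * (M + 3) * #|L i| <= \sum_(v in L i) #|nbr f U v|.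
  rewrite mulnC -sum_nat_const; apply: leq_sum => v /(subsetP (LU i)) vU.
  apply: leq_trans (ltnW (dense _ vU)) _; apply: subset_leq_card.
  by apply/subsetP => x; rewrite !in_nbr /f => /andP[-> ->]; rewrite vU.
have Ladj i j v b : v \in L i -> f v b -> b \in L j -> j = i.+1 \/ i = j.+1.
  move=> vi fvb bj; have := sphere_adj_dist fsym vi bj fvb.
  move: (hchi _ _ (fh _ _ fvb)); rewrite (Lchi _ _ vi) (Lchi _ _ bj).
  case: (eqVneq i j) => [->|ne _ d]; first by rewrite eqxx.
  by clear -ne d; lia.
have : M ^ l <= #|L l|.
  apply: (growth (w := w) (a := fun i => #|L i|) (c := c0)) => //.
  - by rewrite /c0 /layer_const; clear; lia.
  - by rewrite cards1.
  - move=> l0; apply: leq_trans (degL 0) _.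
    rewrite /w -(double_count f (L 0)); apply: leq_sum => v vL; apply: subset_leq_card.
    apply/subsetP => b; rewrite in_nbr inE => /andP[bU fvb].
    have [j ji bj] := sphere_adj vL fvb.
    by rewrite fsym fvb andbT; have [<-|//] := Ladj _ _ _ _ vL fvb bj.
  - move=> i il; apply: leq_trans (degL i.+1) _.
    rewrite /w -(double_count f (L i.+1)) -big_split; apply: leq_sum => v vL.
    apply: leq_trans (leq_card_setU _ _); apply: subset_leq_card.
    apply/subsetP => b; rewrite in_nbr => /andP[bU fvb].
    have [j ji bj] := sphere_adj vL fvb.
    rewrite in_setU in_nbr inE; apply/orP.
    have [ij|[ij]] := Ladj _ _ _ _ vL fvb bj; [right|left].
      by rewrite fsym fvb /L -ij bj.
    by rewrite fvb /L ij bj.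
have := max_card (mem (L l)); move: VM; clear => h1 h2 h3.
by have := leq_trans h1 (leq_trans h3 h2); rewrite ltnn.
Qed.

(** * Berge cycles and rainbow colourings *)

Section Berge.
Variables (m n : nat) (E : {set 'I_m * 'I_n}).

(** A Berge path is a list of pairs (hyperedge, vertex) with [p'.1] joining
    [p.2] to [p'.2]; a closed path is one that returns to the vertex of its
    starting pair. *)
Definition berge_step : rel ('I_n * 'I_m) :=
  fun p p' => ((p.2, p'.1) \in E) && ((p'.2, p'.1) \in E).

Definition weave (s : seq ('I_n * 'I_m)) : seq ('I_m + 'I_n) :=
  flatten [seq [:: inr p.1; inl p.2] | p <- s].

Lemma size_weave s : size (weave s) = 2 * size s.
Proof. by elim: s => //= p s ->; rewrite mulnS. Qed.

Lemma mem_weave_l s a : (inl a \in weave s) = (a \in map snd s).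
Proof. by elim: s => //= p s IH; rewrite !inE IH. Qed.

Lemma mem_weave_r s b : (inr b \in weave s) = (b \in map fst s).
Proof. by elim: s => //= p s IH; rewrite !inE IH. Qed.

Lemma uniq_weave s : uniq (map fst s) -> uniq (map snd s) -> uniq (weave s).
Proof.
elim: s => //= p s IH /andP[n1 u1] /andP[n2 u2].
by rewrite inE mem_weave_l mem_weave_r n1 n2 IH.
Qed.

Lemma path_weave s p : path berge_step p s ->
  path (bip_adj E) (inl p.2) (weave s) /\ last (inl p.2) (weave s) = inl (last p s).2.
Proof.
elim: s p => //= p' s IH p /andP[/andP[e1 e2] /IH[h1 h2]].
by rewrite e1 e2 /=; split.
Qed.

Lemma berge_has_cycle p s :
  s != [::] -> path berge_step p s -> (last p s).2 = p.2 ->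
  uniq (map fst s) -> uniq (map snd s) -> has_cycle (2 * size s) E.
Proof.
move=> s0 /path_weave[ps lst] lp u1 u2; apply/existsP.
have sz : size (weave s) == 2 * size s by rewrite size_weave.
exists (Tuple sz); apply/andP; split; last exact: uniq_weave.
rewrite (cycle_path (inl p.2)) /=.
by rewrite lst lp in ps *.
Qed.

Lemma bip_adj_sym : symmetric (bip_adj E).
Proof. by move=> [x|x] [y|y]. Qed.

Lemma no_cycle_ucycle l c :
  ~~ has_cycle l E -> ucycle (bip_adj E) c -> size c <> l.
Proof.
move=> /existsP nc uc /eqP sc; apply: nc; exists (Tuple sc); exact: uc.
Qed.

(** Hyperedges are chosen greedily: each pair on the path has more candidates
    than there are hyperedges already used or forbidden. *)
Lemma heavy_path (hv : rel 'I_m) K :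
  (forall u v, hv u v -> K <= #|[set b | ((u, b) \in E) && ((v, b) \in E)]|) ->
  forall p q (X : {set 'I_n}), path hv q.2 p -> #|X| + size p <= K ->
  exists s, [/\ path berge_step q s, map snd s = p, uniq (map fst s) &
    {in map fst s, forall b, b \notin X}].
Proof.
move=> hvK; elim=> [|v p IH] q X /=; first by exists [::].
move=> /andP[huv pv] sz.
have : 0 < #|[set b | ((q.2, b) \in E) && ((v, b) \in E)] :\: X|.
  rewrite cardsD subn_gt0; apply: leq_ltn_trans (subset_leq_card (subsetIr _ _)) _.
  have XK : #|X| < K by apply: leq_trans sz; rewrite addnS ltnS leq_addr.
  exact: leq_trans XK (hvK _ _ huv).
case/card_gt0P => b; rewrite !inE => /andP[bX /andP[eb1 eb2]].
have [|s [ps ms us sX]] := IH (b, v) (b |: X) pv.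
  by rewrite cardsU1 bX addSn -addnS.
exists ((b, v) :: s); split=> //=.
- by rewrite /berge_step /= eb1 eb2.
- by rewrite ms.
- by rewrite us andbT; apply/negP => /sX; rewrite setU11.
- by move=> b'; rewrite inE => /orP[/eqP->//|/sX]; rewrite in_setU1 negb_or => /andP[].
Qed.

Lemma heavy_cycle (hv : rel 'I_m) x p :
  0 < n ->
  (forall u v, hv u v -> (size p).+1 <= #|[set b | ((u, b) \in E) && ((v, b) \in E)]|) ->
  ucycle hv (x :: p) -> has_cycle (2 * (size p).+1) E.
Proof.
move=> n0 hvK /andP[/= cp /andP[xp up]].
have [|s [ps ms us _]] := heavy_path hvK (q := (Ordinal n0, x)) (X := set0) cp.
  by rewrite cards0 size_rcons.
have ss : size s = (size p).+1 by rewrite -(size_map snd) ms size_rcons.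
rewrite -ss; apply: (@berge_has_cycle (Ordinal n0, x)) => //.
- by rewrite -size_eq0 ss.
- by rewrite -(last_map snd) ms last_rcons.
- by rewrite ms rcons_uniq xp.
Qed.

End Berge.

Lemma cycle_distinct (T : eqType) (s : seq T) :
  1 < size s -> uniq s -> cycle (fun x y => x != y) s.
Proof.
case: s => [|x [|y s]] // _; rewrite uniq_pairwise => h.
rewrite /cycle rcons_path; have /= -> := pairwise_sorted h; rewrite /=.
move: h; rewrite -uniq_pairwise cons_uniq => /andP[h _].
by apply: contraNneq h => <-; apply: mem_last.
Qed.

(** Average over all 3-colourings: overwriting three given vertices by the
    prescribed colours loses only their old colours, so at least one colouring
    in 27 is good for a given [b]. *)
Lemma rainbow_colouring (V I : finType) (F : {set I}) (x y z : I -> V) :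
  (forall b, b \in F -> [&& x b != y b, x b != z b & y b != z b]) ->
  exists chi : V -> 'I_3, #|F| <= 27 * #|[set b in F |
    [&& chi (x b) == inord 0, chi (y b) == inord 1 & chi (z b) == inord 2]]|.
Proof.
move=> dist.
pose good (chi : {ffun V -> 'I_3}) b :=
  [&& chi (x b) == inord 0, chi (y b) == inord 1 & chi (z b) == inord 2].
have [/existsP[chi h]|] := boolP [exists chi : {ffun V -> 'I_3}, #|F| <= 27 * #|[set b in F | good chi b]|].
  by exists chi.
rewrite negb_exists => /forallP no; exfalso.
have many b : b \in F -> #|{ffun V -> 'I_3}| <= 27 * #|[set chi | good chi b]|.
  move=> bF; have /and3P[xy xz yz] := dist b bF.
  pose mend (chi : {ffun V -> 'I_3}) : {ffun V -> 'I_3} := [ffun v =>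
    if v == x b then inord 0 else if v == y b then inord 1
    else if v == z b then inord 2 else chi v].
  (* the old colours of the three vertices are recorded, so nothing is lost *)
  pose code chi := (mend chi, (chi (x b), chi (y b), chi (z b))).
  have inj : injective code.
    move=> c1 c2 [/ffunP eqm ex ey ez]; apply/ffunP => v; have := eqm v.
    by rewrite !ffunE; case: eqP => [->//|_]; case: eqP => [->//|_]; case: eqP => [->|].
  rewrite -cardsT -(card_imset _ inj).
  have -> : 27 * #|[set chi | good chi b]| =
      #|setX [set chi | good chi b] [set: 'I_3 * 'I_3 * 'I_3]|.
    by rewrite cardsX cardsT !card_prod !card_ord mulnC.
  apply: subset_leq_card; apply/subsetP => _ /imsetP[chi _ ->].
  rewrite !inE andbT /good !ffunE !eqxx.
  rewrite (eq_sym (y b) (x b)) (negPf xy) (eq_sym (z b) (x b)) (negPf xz).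
  by rewrite (eq_sym (z b) (y b)) (negPf yz) !eqxx.
have few : \sum_(chi : {ffun V -> 'I_3}) 27 * #|[set b in F | good chi b]| <= #|{ffun V -> 'I_3}| * #|F|.-1.
  rewrite -sum_nat_const; apply: leq_sum => chi _.
  by have := no chi; rewrite -ltnNge; case: #|F|.
have cF : 0 < #|F| by have := no [ffun _ => ord0]; rewrite -ltnNge; case: #|F|.
have cN : 0 < #|{ffun V -> 'I_3}| by apply/card_gt0P; exists [ffun _ => ord0].
have : #|F| * #|{ffun V -> 'I_3}| <= \sum_(chi : {ffun V -> 'I_3}) 27 * #|[set b in F | good chi b]|.
  rewrite -big_distrr /=.
  rewrite (eq_bigr (fun chi : {ffun V -> 'I_3} => \sum_(b in F) good chi b)) => [|chi _]; last exact: card_set_sum.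
  rewrite exchange_big big_distrr -sum_nat_const /=; apply: leq_sum => b bF.
  apply: leq_trans (many b bF) _; rewrite leq_mul2l /=.
  rewrite -sum1_card big_mkcond /=; apply: leq_sum => chi _.
  by rewrite inE; case: (good chi b).
move/leq_trans/(_ few); rewrite mulnC leq_pmul2l //; move: cF; clear; lia.
Qed.

(** * Lifting an even cycle of light pairs *)

Lemma pairmap_rcons (V I : Type) (f : V -> V -> I) a p v :
  pairmap f a (rcons p v) = rcons (pairmap f a p) (f (last a p) v).
Proof. by rewrite -!cats1 pairmap_cat. Qed.

(** [ends] recovers an edge from its label, so a label used twice would put
    the first vertex [a] on the rest of the path. *)
Lemma uniq_edge_labels (V I : finType) (h : rel V) (lab : V -> V -> I) (ends : I -> {set V}) :
  (forall u v, h u v -> ends (lab u v) = [set u; v]) ->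
  forall p a, path h a p -> uniq (a :: p) ->
  uniq (pairmap lab a p) /\
  {in pairmap lab a p, forall b, ends b \subset [set v in a :: p]}.
Proof.
move=> labP; elim=> [|v p IH] a; first by split.
move=> /andP[hav pv] /andP[aNp up]; have [u1 sub1] := IH v pv up.
split=> /=.
  rewrite u1 andbT; apply/negP => /sub1/subsetP/(_ a).
  by rewrite labP // !inE eqxx => /(_ isT); move: aNp; rewrite inE => /negP.
move=> b; rewrite inE => /orP[/eqP->|/sub1 sub]; last first.
  by apply: subset_trans sub _; apply/subsetP => w; rewrite !inE => ->; rewrite orbT.
by rewrite labP //; apply/subsetP => w; rewrite !inE => /orP[->|->]; rewrite ?orbT.
Qed.

(** The length hypothesis is needed because the closing edge of a cycle with
    two vertices coincides with its other edge. *)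
Lemma uniq_cycle_labels (V I : finType) (h : rel V) (lab : V -> V -> I) (ends : I -> {set V}) :
  (forall u v, h u v -> ends (lab u v) = [set u; v]) ->
  forall a p, 1 < size p -> path h a (rcons p a) -> uniq (a :: p) ->
  uniq (pairmap lab a (rcons p a)).
Proof.
move=> labP a [|v p] // sp; rewrite rcons_path => /andP[pp hla] up.
have [up' _] := uniq_edge_labels labP pp up.
rewrite pairmap_rcons rcons_uniq up' andbT /=.
move: pp => /= /andP[hav pv]; move: (up) => /= /andP[aNvp up2].
have [_ sub] := uniq_edge_labels labP pv up2.
apply/negP; rewrite inE => /orP[/eqP eqlab|/sub].
  have := labP _ _ hla; rewrite eqlab labP // => /setP/(_ v).
  rewrite !inE eqxx orbT => /esym/orP[/eqP vl|/eqP va].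
    case: p sp up2 {hla eqlab pv sub up up' aNvp} vl => // w p _ /= /andP[vNp _] vl.
    by move: vNp; rewrite vl mem_last.
  by move: aNvp; rewrite va mem_head.
by rewrite labP //= => /subsetP/(_ a); rewrite !inE eqxx orbT => /(_ isT); rewrite -in_cons (negPf aNvp).
Qed.

Lemma labelled_path (m n : nat) (E : {set 'I_m * 'I_n}) (h : rel 'I_m)
    (lab : 'I_m -> 'I_m -> 'I_n) :
  (forall u v, h u v -> ((u, lab u v) \in E) && ((v, lab u v) \in E)) ->
  forall p q, path h q.2 p ->
  path (berge_step E) q (pairmap (fun u v => (lab u v, v)) q.2 p).
Proof.
move=> labE; elim=> //= v p IH q /andP[hv /(IH (lab q.2 v, v)) ->].
by rewrite /berge_step /= labE.
Qed.

Lemma pairmap_snd (V I : Type) (lab : V -> V -> I) p a :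
  map snd (pairmap (fun u v => (lab u v, v)) a p) = p.
Proof. by elim: p a => //= v p IH a; rewrite IH. Qed.

Lemma pairmap_fst (V I : Type) (lab : V -> V -> I) p a :
  map fst (pairmap (fun u v => (lab u v, v)) a p) = pairmap lab a p.
Proof. by elim: p a => //= v p IH a; rewrite IH. Qed.

(** The graph [h] of the pairs [x b], [y b] has at least one edge for every
    [K] elements of [F] that are coloured correctly. It is bipartite, so the
    cycle can be rotated to make its closing edge run from the [x b] to the [y
    b] of its label [b]; that edge takes the detour through [z b], whose
    colour is not used by any vertex of the cycle. *)
Lemma light_family_bound (m n k l K M : nat) (E : {set 'I_m * 'I_n})
    (F : {set 'I_n}) (x y z : 'I_n -> 'I_m) :
  1 < l -> k = l.*2 \/ k = l.*2.+1 -> ~~ has_cycle (2 * k) E ->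
  (forall b, b \in F -> [&& x b != y b, x b != z b & y b != z b]) ->
  (forall b, b \in F -> [&& (x b, b) \in E, (y b, b) \in E & (z b, b) \in E]) ->
  (forall b, b \in F -> k <= #|[set b' | ((y b, b') \in E) && ((z b, b') \in E)]|) ->
  (forall u v, #|[set b in F | (x b == u) && (y b == v)]| <= K) ->
  0 < M -> m < M ^ l ->
  #|F| <= 27 * (K * (2 * (layer_const l 1 * (M + 3)) * m)).
Proof.
move=> l1 kl noC dist inE_ heavy light M0 mM.
have [chi Fchi] := rainbow_colouring dist.
apply: leq_trans Fchi _; rewrite leq_mul2l /=.
set G := [set b in F | _].
have GF b : b \in G -> b \in F by rewrite inE => /andP[].
have Gchi b : b \in G -> [/\ chi (x b) = inord 0, chi (y b) = inord 1 & chi (z b) = inord 2].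
  by rewrite inE => /andP[_ /and3P[/eqP-> /eqP-> /eqP->]].
pose ends b := [set x b; y b].
pose h : rel 'I_m := fun u v => [exists b, (b \in G) && (((x b == u) && (y b == v)) || ((x b == v) && (y b == u)))].
have hsym : symmetric h.
  by move=> u v; apply: eq_existsb => b; rewrite orbC.
pose red u := chi u == inord 0.
have i10 : (inord 1 == inord 0 :> 'I_3) = false by apply/negP => /eqP/(congr1 (@nat_of_ord 3)); rewrite !inordK.
have i20 : (inord 2 == inord 0 :> 'I_3) = false by apply/negP => /eqP/(congr1 (@nat_of_ord 3)); rewrite !inordK.
have i21 : (inord 2 == inord 1 :> 'I_3) = false by apply/negP => /eqP/(congr1 (@nat_of_ord 3)); rewrite !inordK.
have hred u v : h u v -> red u != red v.
  case/existsP => b /andP[/Gchi[cx cy _] /orP[/andP[/eqP<- /eqP<-]|/andP[/eqP<- /eqP<-]]];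
  by rewrite /red cx cy i10 eqxx.
have hnz u v : h u v -> chi u != inord 2.
  case/existsP => b /andP[/Gchi[cx cy _] /orP[/andP[/eqP<- _]|/andP[_ /eqP<-]]];
  by rewrite ?cx ?cy eq_sym ?i20 ?i21.
have hnoC c : ucycle h c -> size c <> 2 * l.
  (* rotate the cycle so that it starts at a vertex of the colour of the y b *)
  wlog: c / if c is u :: _ then ~~ red u else false.
    case: c => [|u [|v c]] H; [by move=> _ /=; clear -l1; lia|by move=> _ /=; clear -l1; lia|].
    case: (boolP (red u)) => [ru|nru]; last by apply: H.
    move=> uc sc; apply: (H (rot 1 [:: u, v & c])); last by rewrite size_rot.
      rewrite rot1_cons /=; have : h u v by case/andP: uc => /= /andP[].
      by move/hred; rewrite ru; case: (red v).
    by rewrite rot_ucycle.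
  case: c => // u p nru /andP[cp up] sp.
  have sp1 : 1 < size p by clear -sp l1; move: sp => /=; lia.
  pose c' := rcons p u.
  have hl : h (last u p) u by move: cp; rewrite /= rcons_path => /andP[].
  have [b0 _] : exists b0, b0 \in G by case/existsP: hl => b /andP[bG _]; exists b.
  pose lab u v := odflt b0 [pick b in G | ((x b == u) && (y b == v)) || ((x b == v) && (y b == u))].
  have labP a v : h a v -> [/\ lab a v \in G & (x (lab a v) = a /\ y (lab a v) = v) \/ (x (lab a v) = v /\ y (lab a v) = a)].
    move=> /existsP[b hb]; rewrite /lab; case: pickP => [b' /andP[b'G /orP[/andP[/eqP-> /eqP->]|/andP[/eqP-> /eqP->]]] /=|/(_ b)].
    - by split=> //; left.
    - by split=> //; right.
    - by rewrite hb.
  have labends a v : h a v -> ends (lab a v) = [set a; v].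
    by move/labP=> [_ [[xE yE]|[xE yE]]]; rewrite /ends xE yE // setUC.
  have labE a v : h a v -> ((a, lab a v) \in E) && ((v, lab a v) \in E).
    move/labP=> [/GF/inE_/and3P[xE yE _] [[xa yv]|[xv ya]]].
      by rewrite -{1}xa -{3}yv xE yE.
    by rewrite -{1}ya -{3}xv xE yE.
  pose w := pairmap (fun u v => (lab u v, v)).
  have labU : uniq (pairmap lab u (rcons p u)) by exact: uniq_cycle_labels labends _ _ _ _ _.
  have pwhole := labelled_path labE (q := (b0, u)) cp.
  have sizew : size (w u (rcons p u)) = l.*2.
    by rewrite size_pairmap size_rcons -[_.+1]/(size (u :: p)) sp mul2n.
  have rcU : uniq (rcons p u) by rewrite rcons_uniq.
  case: kl => kE; move/negP: noC; apply; rewrite kE.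
    rewrite -sizew; apply: (@berge_has_cycle _ _ _ (b0, u)) => //.
    - by rewrite -size_eq0 sizew; clear -l1; case: l l1.
    - by rewrite -(last_map snd) pairmap_snd last_rcons.
    - by rewrite pairmap_fst.
    - by rewrite pairmap_snd.
  (* the closing edge joins x b to y b = u; as k = 2l+1, a common neighbour b'
     of y b and z b remains that is not a label of the cycle *)
  have [bG xy] := labP _ _ hl; set b := lab (last u p) u in bG xy.
  have [xb yb] : x b = last u p /\ y b = u.
    case: xy => // [[xu _]]; have [cx _ _] := Gchi _ bG.
    by move: nru; rewrite /red -xu cx eqxx.
  have [b' b'G b'N] : exists2 b', b' \in [set b' | ((y b, b') \in E) && ((z b, b') \in E)] &
      b' \notin pairmap lab u (rcons p u).
    apply/exists_inP; apply: contraT; rewrite negb_exists_in => /forall_inP all_in.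
    have : #|[set b' | ((y b, b') \in E) && ((z b, b') \in E)]| <= size (pairmap lab u (rcons p u)).
      apply: leq_trans (card_size _); apply: subset_leq_card; apply/subsetP => b' hb'.
      by have := all_in _ hb'; rewrite negbK.
    have := heavy _ (GF _ bG); rewrite kE size_pairmap size_rcons.
    by move=> h1 /(leq_trans h1); rewrite -[_.+1 in X in _ <= X]/(size (u :: p)) sp -mul2n ltnn.
  rewrite !inE in b'G; case/andP: b'G => yb' zb'.
  have /and3P[xE yE zE] := inE_ _ (GF _ bG).
  have [_ _ cz] := Gchi _ bG.
  have pcz v : v \in u :: p -> v != z b.
    move=> vp; apply/eqP => vz; have := hnz _ _ (next_cycle cp vp).
    by rewrite vz cz eqxx.
  have prc : pairmap lab u (rcons p u) = rcons (pairmap lab u p) b.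
    exact: pairmap_rcons.
  have pp : path h u p by move: cp; rewrite /= rcons_path => /andP[].
  have s2 : size (w u p) = (l.*2).-1.
    rewrite size_pairmap -mul2n -sp //.
  have -> : l.*2.+1 = size (w u p ++ [:: (b, z b); (b', u)]).
    rewrite size_cat s2 /= -subn1; clear -l1; lia.
  apply: (@berge_has_cycle _ _ _ (b0, u)).
  - by rewrite -size_eq0 size_cat addn2.
  - rewrite cat_path; apply/andP; split; first exact: (labelled_path labE (q := (b0, u)) pp).
    have lw : (last (b0, u) (w u p)).2 = x b by rewrite -(last_map snd) pairmap_snd xb.
    by rewrite /= /berge_step lw -yb xE zE zb' yb'.
  - by rewrite last_cat.
  - rewrite map_cat pairmap_fst /= -cat_rcons cats1 -prc.
    by rewrite rcons_uniq b'N labU.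
  - rewrite map_cat pairmap_snd /= -cat_rcons cats1.
    have /andP[uNp upp] : (u \notin p) && uniq p by [].
    rewrite rcons_uniq mem_rcons inE rcons_uniq upp negb_or uNp !andbT pcz ?mem_head //=.
    by apply/negP => zp; have := pcz (z b); rewrite inE zp orbT eqxx => /(_ isT).
have mM' : #|'I_m| < M ^ l by rewrite card_ord.
have := bipartite_even_cycle_bound hsym hred hnoC M0 mM'; rewrite card_ord => bound.
apply: leq_trans (_ : K * (\sum_(u : 'I_m) #|nbr h setT u|) <= _); last by rewrite leq_mul2l bound orbT.
rewrite big_distrr /=.
have -> : #|G| = \sum_(u : 'I_m) \sum_(v : 'I_m) #|[set b in G | (x b == u) && (y b == v)]|.
  rewrite -sum1_card (partition_big x predT) //=; apply: eq_bigr => u _.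
  rewrite (partition_big y predT) //=; apply: eq_bigr => v _.
  by rewrite -sum1_card; apply: eq_bigl => b; rewrite !inE -!andbA.
apply: leq_sum => u _; rewrite mulnC -sum_nat_const [X in _ <= X]big_mkcond /=.
apply: leq_sum => v _; rewrite in_nbr in_setT /=; case: ifP => huv.
  apply: leq_trans (light u v); apply: subset_leq_card; apply/subsetP => b.
  by rewrite inE => /andP[/GF bF xyb]; rewrite inE bF.
rewrite leqn0 cards_eq0; apply/eqP/setP => b; rewrite in_set in_set0; apply/negP => /andP[bG xyb].
by move/negbT/negP: huv; apply; apply/existsP; exists b; rewrite bG xyb.
Qed.

(** * Counting edges by the degrees of right vertices *)

Definition right_nbrs (m n : nat) (E : {set 'I_m * 'I_n}) b := [set a | (a, b) \in E].
Definition codeg (m n : nat) (E : {set 'I_m * 'I_n}) u v :=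
  #|[set b | ((u, b) \in E) && ((v, b) \in E)]|.

Lemma has_cycle_mono (m n l : nat) (E' E : {set 'I_m * 'I_n}) :
  E' \subset E -> has_cycle l E' -> has_cycle l E.
Proof.
move=> /subsetP sub /existsP[c uc]; apply/existsP; exists c; move: uc; apply: sub_ucycle.
by move=> [x|x] [y|y] //=; apply: sub.
Qed.

Lemma right_degree_excess_bound (m n k K l q1 q2 M : nat) (E : {set 'I_m * 'I_n}) :
  ~~ has_cycle (2 * k) E -> 2 * l <= k -> 1 < q1 -> 0 < q2 ->
  (2 * k + 3 <= q1 /\ 2 * k + 3 <= q2) \/ (forall u v, u != v -> codeg E u v <= K) ->
  0 < M -> m < M ^ l ->
  \sum_(b : 'I_n) (#|right_nbrs E b| - (q1 + q2)) <=
    (q1 + q2 + 1) * layer_const k K * (M + 3) * m.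
Proof.
move=> noC lk q1g q2g spr M0 mM.
pose A : {set 'I_m + 'I_n} := [set inl a | a : 'I_m].
have inlA a : inl a \in A by apply: imset_f.
have inrA b : (inr b \in A) = false by apply/negP => /imsetP[].
have cA : #|A| = m by rewrite card_imset ?card_ord // => a a' [].
have bip x y : bip_adj E x y -> (x \in A) != (y \in A).
  by case: x y => [x|x] [y|y] //= _; rewrite inlA inrA.
have sp q : (2 * k + 3 <= q) \/ (forall u v, u != v -> codeg E u v <= K) -> large_or_light (bip_adj E) A k K q.
  case=> [|light]; [by left|right] => _ _ /imsetP[u _ ->] /imsetP[v _ ->] uv.
  apply: leq_trans (light u v _); last by apply: contraNneq uv => ->.
  rewrite /codeg -(card_imset _ (@inr_inj 'I_m 'I_n)); apply: subset_leq_card; apply/subsetP => -[b|b].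
    by rewrite inE.
  by rewrite inE => h; apply/imsetP; exists b; rewrite // inE.
have sp1 : large_or_light (bip_adj E) A k K q1 by apply: sp; case: spr => [[]|]; [left|right].
have sp2 : large_or_light (bip_adj E) A k K q2 by apply: sp; case: spr => [[]|]; [left|right].
have := degree_excess_bound (bip_adj_sym E) bip (fun c => @no_cycle_ucycle _ _ E _ c noC) lk q1g q2g sp1 sp2 M0.
rewrite cA => /(_ mM); apply: leq_trans; rewrite [X in _ <= X]big_mkcond [X in _ <= X]big_sumType /=.
apply: leq_trans (leq_addl _ _); apply: leq_sum => b _.
rewrite inE inrA /=; apply: leq_sub2r.
rewrite -(card_imset _ (@inl_inj 'I_m 'I_n)); apply: subset_leq_card.
apply/subsetP => _ /imsetP[a aE ->]; rewrite in_nbr inlA /=.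
by move: aE; rewrite inE.
Qed.

Definition above (m n : nat) (E : {set 'I_m * 'I_n}) (Q : {set 'I_n}) : {set 'I_m * 'I_n} :=
  [set p in E | p.2 \in Q].

Lemma above_no_cycle m n (E : {set 'I_m * 'I_n}) Q l :
  ~~ has_cycle l E -> ~~ has_cycle l (above E Q).
Proof. by apply: contra; apply: has_cycle_mono; apply/subsetP => p; rewrite inE => /andP[]. Qed.

Lemma right_nbrs_above m n (E : {set 'I_m * 'I_n}) (Q : {set 'I_n}) b :
  b \in Q -> right_nbrs (above E Q) b = right_nbrs E b.
Proof. by move=> bQ; apply/setP => a; rewrite !inE bQ andbT. Qed.

Lemma large_degree_sum (m n k l M : nat) (E : {set 'I_m * 'I_n}) :
  ~~ has_cycle (2 * k) E -> 2 * l <= k -> 0 < M -> m < M ^ l ->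
  \sum_(b : 'I_n | 4 * k + 7 <= #|right_nbrs E b|) #|right_nbrs E b| <=
    (4 * k + 7) * ((4 * k + 7) * layer_const k 0 * (M + 3) * m).
Proof.
move=> noC lk M0 mM; set Q := [set b | 4 * k + 7 <= #|right_nbrs E b|].
have := @right_degree_excess_bound m n k 0 l (2 * k + 3) (2 * k + 3) M (above E Q) (above_no_cycle _ noC) lk.
have -> : 2 * k + 3 + (2 * k + 3) = 4 * k + 6 by clear; lia.
have -> : 4 * k + 6 + 1 = 4 * k + 7 by clear; lia.
have q1 : 1 < 2 * k + 3 by clear; lia.
move=> /(_ q1 (ltnW q1) (or_introl (conj (leqnn _) (leqnn _))) M0 mM) bound.
apply: leq_trans (_ : (4 * k + 7) * (\sum_(b : 'I_n) (#|right_nbrs (above E Q) b| - (4 * k + 6))) <= _).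
  2: by rewrite leq_mul2l bound orbT.
rewrite big_distrr big_mkcond /=; apply: leq_sum => b _; case: ifP => // big.
rewrite right_nbrs_above ?inE //; move: #|_| big => d; clear => big.
have [x ->] : exists x, d = 4 * k + 7 + x by exists (d - (4 * k + 7)); lia.
have -> : 4 * k + 7 + x - (4 * k + 6) = x.+1 by lia.
by rewrite mulnS leq_add2l leq_pmull // addnS.
Qed.

Lemma all_light_card (m n k l K M : nat) (E : {set 'I_m * 'I_n}) (Q : {set 'I_n}) :
  ~~ has_cycle (2 * k) E -> 2 * l <= k -> 0 < M -> m < M ^ l ->
  (forall b, b \in Q -> 4 <= #|right_nbrs E b|) ->
  (forall u v, u != v -> codeg (above E Q) u v <= K) ->
  #|Q| <= 4 * layer_const k K * (M + 3) * m.
Proof.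
move=> noC lk M0 mM Q4 light.
have := @right_degree_excess_bound m n k K l 2 1 M (above E Q) (above_no_cycle _ noC) lk isT isT (or_intror light) M0 mM.
apply: leq_trans; rewrite -sum1_card big_mkcond /=; apply: leq_sum => b _.
case: ifP => // bQ; rewrite right_nbrs_above // subn_gt0; exact: Q4.
Qed.

(** If a related pair uv and an unrelated pair xy share no vertex, the pair xu
    is of one of the two kinds and shares a vertex with the pair of the other
    kind. *)
Lemma mixed_pair_triple (V : finType) (N : {set V}) (hv : rel V) :
  symmetric hv ->
  (exists u v, [/\ u \in N, v \in N, u != v & hv u v]) ->
  (exists u v, [/\ u \in N, v \in N, u != v & ~~ hv u v]) ->
  exists x y z, [/\ [&& x \in N, y \in N & z \in N], [&& x != y, x != z & y != z],
    ~~ hv x y & hv y z].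
Proof.
move=> hsym [u [v [uN vN uv huv]]] [x [y [xN yN xy nxy]]].
have [xu|xu] := eqVneq x u.
  subst u; exists y, x, v; rewrite xN yN vN (eq_sym y) xy hsym nxy huv uv; split=> //.
  by rewrite andbT /=; apply: contraNneq nxy => ->.
have [hxu|nxu] := boolP (hv x u); last first.
  have [xv|xv] := eqVneq x v; first by move: nxu; rewrite xv hsym huv.
  by exists x, u, v; rewrite xN uN vN xu xv uv nxu huv.
exists y, x, u; rewrite xN yN uN (eq_sym y) xy xu hsym nxy hxu; split=> //.
by rewrite andbT /=; apply: contraNneq nxy => ->.
Qed.

(** For l = 1 the light pairs are counted directly, since there are at most
    m^2 <= M m of them. For l > 1 we have k > 3, as [all_light_card] requires.
    *)
Lemma card_degree_ge (k : nat) : 1 < k ->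
  exists c, forall m n M (E : {set 'I_m * 'I_n}),
  ~~ has_cycle (2 * k) E -> 0 < M -> m < M ^ (k %/ 2) ->
  #|[set b | k <= #|right_nbrs E b|]| <= c * (M * m).
Proof.
move=> k1; set l := k %/ 2.
have lk : 2 * l <= k by rewrite mulnC leq_trunc_div.
have kl : k = l.*2 \/ k = l.*2.+1.
  rewrite /l divn2; have := odd_double_half k; case: (odd k) => /= <-; rewrite ?add1n ?add0n.
    by right; rewrite /= uphalf_double.
  by left; rewrite doubleK.
exists (k + 16 * layer_const k k + 27 * (k * (8 * layer_const l 1))) => m n M E noC M0 mM.
set B := [set b | k <= #|right_nbrs E b|].
have degB b : b \in B -> k <= #|right_nbrs E b| by rewrite inE.
pose cd u v := #|[set b in B | ((u, b) \in E) && ((v, b) \in E)]|.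
pose hv : rel 'I_m := fun u v => k <= cd u v.
have cd_le u v : cd u v <= codeg E u v.
  by apply: subset_leq_card; apply/subsetP => b; rewrite !inE => /andP[].
have hvsym : symmetric hv.
  by move=> u v; rewrite /hv /cd; congr (_ <= #|pred_of_set _|); apply/setP => b; rewrite !inE [(_ && ((u, b) \in E))]andbC.
have haslight b : b \in B -> exists u v, [/\ u \in right_nbrs E b, v \in right_nbrs E b, u != v & ~~ hv u v].
  move=> bB; case: (boolP [exists u, exists v, [&& u \in right_nbrs E b, v \in right_nbrs E b, u != v & ~~ hv u v]]).
    by case/existsP=> u /existsP[v /and4P[]]; exists u, v.
  rewrite negb_exists => /forallP no; exfalso; move/negP: noC; apply.
  set p := take k (enum (right_nbrs E b)).
  have sp : size p = k by rewrite size_takel // -cardE; exact: degB.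
  have up : uniq p by rewrite take_uniq // enum_uniq.
  have pN u : u \in p -> u \in right_nbrs E b by move/mem_take; rewrite mem_enum.
  have cp : cycle hv p.
    have := cycle_distinct (_ : 1 < size p) up; rewrite sp => /(_ k1).
    apply: (sub_in_cycle (P := mem p)); last by apply/allP.
    move=> u v up' vp' uv; have := no u; rewrite negb_exists => /forallP/(_ v).
    by rewrite (pN _ up') (pN _ vp') uv /= negbK.
  case: p sp up pN cp => [|x p] sp up pN cp; first by rewrite -sp in k1.
  rewrite -sp /=; apply: (@heavy_cycle _ _ _ hv x p); first by case: (n) b {bB no pN} => // -[].
    by move=> u v huv; apply: leq_trans (cd_le u v); rewrite -[_.+1]/(size (x :: p)) sp.
  by apply/andP; split.
have [l1|l1] := leqP l 1.
  have mM1 : m <= M.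
    by apply: ltnW; apply: leq_trans mM _; case: (l) l1 => [|[|]] //; rewrite ?expn1 ?expn0.
  apply: leq_trans (_ : k * (M * m) <= _); last by rewrite leq_mul2r -addnA leq_addr orbT.
  apply: leq_trans (_ : k * (m * m) <= _); last by rewrite leq_mul2l leq_mul2r mM1 !orbT.
  have : B \subset \bigcup_(p in [set p | ~~ hv p.1 p.2]) [set b in B | ((p.1, b) \in E) && ((p.2, b) \in E)].
    apply/subsetP => b bB; have [u [v [ub vb _ nh]]] := haslight b bB.
    by apply/bigcupP; exists (u, v); rewrite inE //= bB; move: ub vb; rewrite !inE => -> ->.
  move/subset_leq_card/leq_trans; apply; apply: leq_trans (leq_card_bigcup (K := k) _) _.
    by move=> [u v]; rewrite inE /= -ltnNge => /ltnW.
  by rewrite mulnC leq_mul2l; apply/orP; right; apply: leq_trans (max_card _) _; rewrite card_prod card_ord.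
have k4 : 3 < k by move: lk l1; clear; lia.
pose light_all b := [forall u, forall v, [&& u \in right_nbrs E b, v \in right_nbrs E b & u != v] ==> ~~ hv u v].
pose B1 := [set b in B | light_all b]; pose B2 := [set b in B | ~~ light_all b].
have -> : #|B| = #|B1| + #|B2|.
  have -> : B1 = B :&: [set b | light_all b] by apply/setP => b; rewrite !inE.
  have -> : B2 = B :\: [set b | light_all b] by apply/setP => b; rewrite !inE andbC.
  by rewrite cardsID.
have M3 : M + 3 <= 4 * M by move: M0; clear; lia.
have c1 : #|B1| <= 4 * layer_const k k * (M + 3) * m.
  apply: (all_light_card noC lk M0 mM).
    by move=> b; rewrite inE => /andP[/degB bB _]; apply: leq_trans bB.
  move=> u v uv; case: (boolP (hv u v)) => [huv|]; last first.
    rewrite -ltnNge => /ltnW; apply: leq_trans; apply: subset_leq_card.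
    by apply/subsetP => b; rewrite !inE => /andP[/andP[-> /andP[-> _]] /andP[-> _]].
  rewrite /codeg (_ : [set b | _] = set0) ?cards0 //; apply/setP => b; rewrite in_set0 in_set.
  apply/negP => /andP[]; rewrite !in_set /= => /andP[ub /andP[_ /forallP/(_ u)/forallP/(_ v) h]] /andP[vb _].
  by move: h; rewrite !inE ub vb uv huv.
have c2 : #|B2| <= 27 * (k * (2 * (layer_const l 1 * (M + 3)) * m)).
  have [->|/set0Pn[b0 b0B]] := eqVneq B2 set0; first by rewrite cards0.
  pose good b (t : 'I_m * 'I_m * 'I_m) :=
    [&& [&& t.1.1 \in right_nbrs E b, t.1.2 \in right_nbrs E b & t.2 \in right_nbrs E b],
        [&& t.1.1 != t.1.2, t.1.1 != t.2 & t.1.2 != t.2], ~~ hv t.1.1 t.1.2 & hv t.1.2 t.2].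
  have hasgood b : b \in B2 -> exists t, good b t.
    rewrite inE => /andP[bB nall].
    have [|x [y [z [h1 h2 h3 h4]]]] := mixed_pair_triple hvsym _ (haslight b bB).
      move: nall; rewrite negb_forall => /existsP[u]; rewrite negb_forall => /existsP[v].
      by rewrite negb_imply negbK => /andP[/and3P[ub vb uv] huv]; exists u, v.
    by exists (x, y, z); rewrite /good /= h1 h2 h3 h4.
  have [t0 _] := hasgood b0 b0B.
  pose t b := odflt t0 [pick t | good b t].
  have tP b : b \in B2 -> good b (t b).
    by move=> /hasgood[t' gt]; rewrite /t; case: pickP => //= /(_ t'); rewrite gt.
  apply: (light_family_bound (x := fun b => (t b).1.1) (y := fun b => (t b).1.2)
    (z := fun b => (t b).2) l1 kl noC) => //.
  - by move=> b /tP/and4P[].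
  - by move=> b /tP/and4P[]; rewrite !inE.
  - by move=> b /tP/and4P[_ _ _ h]; apply: leq_trans (cd_le _ _).
  - move=> u v; case: (boolP (hv u v)) => [huv|]; last first.
      rewrite -ltnNge => /ltnW; apply: leq_trans; apply: subset_leq_card.
      apply/subsetP => b; rewrite inE => /andP[bB2 /andP[/eqP xu /eqP yv]].
      have /and4P[/and3P[xN yN _] _ _ _] := tP b bB2.
      by move: bB2 xN yN; rewrite xu yv !inE => /andP[-> _] -> ->.
    rewrite (_ : [set b in B2 | _] = set0) ?cards0 //; apply/setP => b; rewrite in_set0 in_set.
    apply/negP => /andP[/tP/and4P[_ _ nh _] /andP[/eqP xu /eqP yv]].
    by move: nh; rewrite xu yv huv.
have cc := leq_add c1 c2; apply: leq_trans cc _.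
set a := layer_const k k; set d := layer_const l 1.
have h1 : 4 * a * (M + 3) * m <= 16 * a * (M * m).
  apply: leq_trans (_ : 4 * a * (4 * M) * m <= _); first by rewrite leq_mul2r leq_mul2l M3 !orbT.
  by apply: eq_leq; clear; lia.
have h2 : 27 * (k * (2 * (d * (M + 3)) * m)) <= 27 * (k * (8 * d)) * (M * m).
  apply: leq_trans (_ : 27 * (k * (2 * (d * (4 * M)) * m)) <= _).
    by rewrite !leq_mul2l leq_mul2r leq_mul2l leq_mul2l M3 !orbT.
  by apply: eq_leq; clear; lia.
apply: leq_trans (leq_add h1 h2) _; rewrite -mulnDl leq_mul2r; apply/orP; right.
by rewrite -addnA leq_addl.
Qed.

(** A right vertex of degree d contributes at most k-1, plus 4k+7 if d >= k,
    plus d if d >= 4k+7. *)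
Lemma edges_le (k : nat) : 1 < k ->
  exists c, forall m n M (E : {set 'I_m * 'I_n}),
  ~~ has_cycle (2 * k) E -> 0 < M -> m < M ^ (k %/ 2) ->
  #|E| <= (k - 1) * n + c * (M * m).
Proof.
move=> k1; have [c1 few] := card_degree_ge k1.
have lk : 2 * (k %/ 2) <= k by rewrite mulnC leq_trunc_div.
exists ((4 * k + 7) * c1 + (4 * k + 7) * ((4 * k + 7) * (layer_const k 0 * 4))) => m n M E noC M0 mM.
have large := large_degree_sum noC lk M0 mM.
have {}few := few _ _ _ _ noC M0 mM.
have -> : #|E| = \sum_(b : 'I_n) #|right_nbrs E b|.
  rewrite -sum1_card (partition_big snd predT) //=; apply: eq_bigr => b _.
  rewrite -(card_imset (right_nbrs E b) (f := fun a => (a, b))); last by move=> a a' [].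
  rewrite sum1_card; apply: eq_card => -[a b']; rewrite unfold_in /=.
  apply/andP/imsetP => [[aE /eqP bb]|[a' a'E [-> ->]]].
    by subst b'; exists a; rewrite // inE.
  by move: a'E; rewrite inE => ->; rewrite eqxx.
apply: leq_trans (_ : \sum_(b : 'I_n) ((k - 1) + ((4 * k + 7) * (k <= #|right_nbrs E b|) +
    (if 4 * k + 7 <= #|right_nbrs E b| then #|right_nbrs E b| else 0))) <= _).
  apply: leq_sum => b _; move: #|_| => d; clear.
  by case: (leqP k d); case: (leqP (4 * k + 7) d); rewrite ?muln1 ?muln0 /=; lia.
rewrite big_split /= sum_nat_const card_ord mulnC leq_add2l big_split /= -big_mkcond /=.
rewrite [X in _ <= X]mulnDl; apply: leq_add.
  rewrite -big_distrr /= -mulnA leq_mul2l /=.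
  have -> : \sum_(b : 'I_n) (k <= #|right_nbrs E b|) = #|[set b | k <= #|right_nbrs E b|]|.
    by rewrite -sum1_card [RHS]big_mkcond; apply: eq_bigr => b _; rewrite inE; case: (k <= _).
  by rewrite few orbT.
apply: leq_trans large _; rewrite -!mulnA !leq_mul2l.
have M3 : M + 3 <= 4 * M by move: M0; clear; lia.
by rewrite [X in _ <= X]mulnA leq_mul2r M3 !orbT.
Qed.

(** * From integers to real exponents *)

Import Order.TTheory GRing.Theory Num.Theory.
Local Open Scope ring_scope.

Theorem proposition5p5 (R : realType) (k : nat) (hk : (2 <= k)%N) :
  exists d : R, 0 < d /\
    forall m n : nat, (0 < m)%N -> (0 < n)%N ->
      (zarankiewicz m n (2 * k))%:R
        <= (k - 1)%:R * n%:R + d * (m%:R `^ (1 + 1 / (k %/ 2)%:R)) :> R.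
Proof.
have [c bound] := edges_le hk.
exists (2 * c%:R + 1); split=> [|m n m0 _]; first by rewrite ltr_wpDl // mulr_ge0.
set l := (k %/ 2)%N in bound *.
have l0 : (0 < l)%N by rewrite divn_gt0.
set p : R := m%:R `^ (1 / l%:R).
have p1 : 1 <= p.
  rewrite -(powRr0 (m%:R : R)) /p ler_powR ?ler1n //.
  by rewrite divr_ge0.
have pl : p ^+ l = m%:R.
  rewrite -powR_mulrn ?powR_ge0 // /p -powRrM div1r mulVf ?powRr1 //.
  by rewrite pnatr_eq0 -lt0n.
have -> : (m%:R : R) `^ (1 + 1 / l%:R) = p * m%:R.
  by rewrite powRD ?powRr1 1?mulrC // pnatr_eq0 -lt0n m0 implybT.
(* the integer part of p, plus one: large enough for m < M ^ l, at most 2 p as p >= 1 *)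
pose M := (Num.truncn p).+1.
have pM : p < M%:R by exact: truncnS_gt.
have Mp : M%:R <= 2 * p.
  rewrite /M -addn1 natrD mulr_natl mulr2n; apply: lerD => //.
  by rewrite truncn_le (le_trans ler01).
have mM : (m < M ^ l)%N.
  rewrite -(ltr_nat R) natrX -pl ltrXn2r ?(le_trans ler01) //.
  by rewrite -lt0n.
have z_le : (zarankiewicz m n (2 * k) <= (k - 1) * n + c * (M * m))%N.
  by apply/bigmax_leqP => E noC; apply: bound.
apply: (@le_trans _ _ ((k - 1) * n + c * (M * m))%:R); first by rewrite ler_nat.
rewrite natrD !natrM lerD2l mulrA [leRHS]mulrA ler_wpM2r //.
apply: (@le_trans _ _ (c%:R * (2 * p))); first by rewrite ler_wpM2l.
by rewrite mulrA [c%:R * 2]mulrC ler_wpM2r ?(le_trans ler01) // lerDl.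
Qed.
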